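(* Under the standing assumptions (1)–(6) listed in the context, $\lim_{m\to\infty}\mathrm{FDR}(\mathrm{ADDOW})$ exists and $$\lim_{m\to\infty}\mathrm{FDR}(\mathrm{ADDOW})\le \alpha .$$ Moreover, if $\alpha\le\bar\pi_0$ and there exists $C\ge 1$ (not depending on $g$) such that $\bar\pi_{g,0}=C\,\pi_{g,0}$ for all $1\le g\le G$, then $$\lim_{m\to\infty}\mathrm{FDR}(\mathrm{ADDOW})=\frac{\alpha}{C}.$$
   Context: Setting. Fix an integer $G\ge2$. For each $m$ one tests $m$ null hypotheses split into $G$ groups of sizes $m_1,\dots,m_G$ (nondecreasing integer sequences depending on $m$, $\sum_g m_g=m$). In group $g$, $H_{g,1},\dots,H_{g,m_g}\in\{0,1\}$ are fixed ($H_{g,i}=0$: the null is true), and the $p$-values $p_{g,1},\dots,p_{g,m_g}$ are $[0,1]$-valued random variables. Let $m_{g,1}=\sum_i H_{g,i}$, $m_{g,0}=m_g-m_{g,1}$, and $U(x)=\mathbf 1\{x>0\}\min(x,1)$. All limits are as $m\to\infty$. Standing assumptions: (1) if $H_{g,i}=0$, $p_{g,i}$ is uniform on $[0,1]$; (2) if $H_{g,i}=1$, $p_{g,i}$ has c.d.f. $F_g$ (not depending on $i$ or $m$), strictly concave on $[0,1]$, with $F_g(0)=0$; (3) there are $\pi_g>0$, $\pi_{g,0}>0$ with $m_g/m\to\pi_g$, $m_{g,0}/m_g\to\pi_{g,0}$, and $\pi_{g,1}=1-\pi_{g,0}>0$, for each $g$; (4) weak dependence: for each $g$ and $t\ge0$,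 in probability, $\frac1{m_{g,0}}\sum_{i}\mathbf 1\{p_{g,i}\le t,H_{g,i}=0\}\to U(t)$ and $\frac1{m_{g,1}}\sum_{i}\mathbf 1\{p_{g,i}\le t,H_{g,i}=1\}\to F_g(t)$ (no assumption on dependence across groups); (5) for each $g$ there is an estimator (random variable) $\hat\pi_{g,0}\in(0,1]$ with $\hat\pi_{g,0}\to\bar\pi_{g,0}$ in probability for some constant $\bar\pi_{g,0}\ge\pi_{g,0}$; (6) the target level satisfies $\alpha\in(\alpha^*,1)$, where $$\alpha^*=\inf_{w\in K^\infty}\frac1{\sum_g\pi_gw_g(\pi_{g,0}+\pi_{g,1}f_g(0^+))},\qquad K^\infty=\Big\{w\in\mathbb R_+^G:\sum_g\pi_g\bar\pi_{g,0}w_g\le1\Big\},$$ $f_g(0^+)=\lim_{x\to0^+}(F_g(x)-F_g(0))/x\in[0,\infty]$ (conventions $1/\infty=0$, $1/0=\infty$, $0\cdot\infty=0$). Put $\bar\pi_0=\sum_g\pi_g\bar\pi_{g,0}$. Procedures. For nondecreasing $h:[0,1]\to[0,1]$ with $h(0)=0$, $\mathcal I(h)=\sup\{u\in[0,1]:h(u)\ge u\}$. For a (possibly random) weight function $W:[0,1]\to\mathbb R_+^G$ (a vector $w$ is viewed as a constant function), $$\widehat G_W(u)=m^{-1}\sum_{g=1}^G\sum_{i=1}^{m_g}\mathbf 1\{p_{g,i}\le\alpha uW_g(u)\}.$$ If $\widehat G_W$ is nondecreasing, let $\hat u_W=\mathcal I(\widehat G_W)$ and $\mathrm{MWBH}(W)=\{(g,i):p_{g,i}\le\alpha\hat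 u_WW_g(\hat u_W)\}$ (set of rejected indices). Let $\widehat K=\{w\in\mathbb R_+^G:\sum_g\frac{m_g}m\hat\pi_{g,0}w_g\le1\}$. Fix any random function $\widehat W^*:[0,1]\to\widehat K$ with $\widehat G_{\widehat W^*}(u)=\max_{w\in\widehat K}\widehat G_w(u)$ for all $u\in[0,1]$ (such a maximum exists, $\widehat G_{\widehat W^*}$ is nondecreasing, and the results do not depend on the choice; random functions are understood to be such that the quantities considered are measurable). $\mathrm{ADDOW}=\mathrm{MWBH}(\widehat W^* )$. Criterion. For a procedure $R$ (random set of rejected indices) and $\mathcal H_0=\{(g,i):H_{g,i}=0\}$, $\mathrm{FDR}(R)=\mathbb E\big[|R\cap\mathcal H_0|/(|R|\vee1)\big]$. *)

(* Defs.v *)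
From HB Require Import structures.
From mathcomp Require Import all_boot all_order all_algebra.
From mathcomp Require Import all_classical all_reals all_analysis.
Import Order.TTheory GRing.Theory Num.Theory.
Import numFieldNormedType.Exports.

Set Implicit Arguments.
Unset Strict Implicit.
Unset Printing Implicit Defensive.

Local Open Scope classical_set_scope.
Local Open Scope ring_scope.

Definition Ucdf {R : realType} (x : R) : R := (0 < x)%R%:R * Num.min x 1.

Definition strictly_concave01 {R : realType} (F : R -> R) : Prop :=
  forall x y t : R, 0 <= x <= 1 -> 0 <= y <= 1 -> x != y -> 0 < t < 1 ->
    t * F x + (1 - t) * F y < F (t * x + (1 - t) * y).

(* f(0^+), with values in the extended reals. The limit exists when F is
   concave on [0,1]. *)
Definition slope0 {R : realType} (F : R -> R) : \bar R :=
  lim (((F x - F 0) / x)%:E @[x --> 0^'+]).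

Definition cvg_in_prob {d : measure_display} {T : measurableType d}
    {R : realType} (P : probability T R) (X : nat -> T -> R) (c : R) : Prop :=
  forall e : R, 0 < e ->
    P [set w | e <= `|X m w - c|] @[m --> \oo] --> 0%E.

(* Group sizes are n : 'I_G -> nat, and the hypotheses are the pairs (g, i) with
   i < n g. [H g i] is true when the null hypothesis (g, i) is false. *)
Definition hyps (G : nat) (n : 'I_G -> nat) : finType := {g : 'I_G & 'I_(n g)}.

Definition true_nulls (G : nat) (n : 'I_G -> nat)
    (H : forall g, 'I_(n g) -> bool) : {set hyps n} :=
  [set j : hyps n | ~~ H (tag j) (tagged j)]%SET.

Definition nb_alt (k : nat) (H : 'I_k -> bool) : nat := (\sum_(i < k) H i)%N.

Definition nb_null (k : nat) (H : 'I_k -> bool) : nat := (k - nb_alt H)%N.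

Definition ecdf_null {R : realType} (k : nat) (H : 'I_k -> bool)
    (q : 'I_k -> R) (t : R) : R :=
  (nb_null H)%:R^-1 * \sum_(i < k) ((q i <= t)%R && ~~ H i)%:R.

Definition ecdf_alt {R : realType} (k : nat) (H : 'I_k -> bool)
    (q : 'I_k -> R) (t : R) : R :=
  (nb_alt H)%:R^-1 * \sum_(i < k) ((q i <= t)%R && H i)%:R.

Definition Kinf {R : realType} (G : nat) (pi pibar0 : 'I_G -> R) :
    set ('I_G -> R) :=
  [set w | (forall g, 0 <= w g) /\ \sum_(g < G) pi g * pibar0 g * w g <= 1].

(* The extended-real operations satisfy 0^-1 = +oo, +oo^-1 = 0 and
   0 * +oo = 0. *)
Definition alpha_star {R : realType} (G : nat) (pi pi0 pibar0 : 'I_G -> R)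
    (F : 'I_G -> R -> R) : \bar R :=
  ereal_inf [set ((\sum_(g < G) (pi g * w g)%:E *
                    ((pi0 g)%:E + (1 - pi0 g)%:E * slope0 (F g)))^-1)%E
            | w in Kinf pi pibar0].

Definition crossing {R : realType} (h : R -> R) : R :=
  sup [set u | 0 <= u <= 1 /\ u <= h u].

(* In the next definitions q g i is the realized value of the p-value (g, i). *)
Definition Ghat {R : realType} (G m : nat) (n : 'I_G -> nat)
    (q : forall g, 'I_(n g) -> R) (alpha : R) (W : R -> 'I_G -> R) (u : R) : R :=
  m%:R^-1 * \sum_(g < G) \sum_(i < n g) (q g i <= alpha * u * W u g)%R%:R.

Definition MWBH {R : realType} (G m : nat) (n : 'I_G -> nat)
    (q : forall g, 'I_(n g) -> R) (alpha : R) (W : R -> 'I_G -> R) :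
    {set hyps n} :=
  let uhat := crossing (Ghat m q alpha W) in
  [set j : hyps n | (q (tag j) (tagged j) <= alpha * uhat * W uhat (tag j))%R]%SET.

Definition Khat {R : realType} (G m : nat) (n : 'I_G -> nat)
    (pihat0 : 'I_G -> R) : set ('I_G -> R) :=
  [set w | (forall g, 0 <= w g) /\
           \sum_(g < G) (n g)%:R / m%:R * pihat0 g * w g <= 1].

(* Since W u belongs to Khat, the second clause says that Ghat at W attains at u
   the maximum over w in Khat of the values of Ghat at the constant weight w. *)
Definition optimal_weights {R : realType} (G m : nat) (n : 'I_G -> nat)
    (q : forall g, 'I_(n g) -> R) (pihat0 : 'I_G -> R) (alpha : R)
    (W : R -> 'I_G -> R) : Prop :=
  forall u : R, 0 <= u <= 1 ->
    Khat m n pihat0 (W u) /\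
    forall w : 'I_G -> R, Khat m n pihat0 w ->
      Ghat m q alpha (fun=> w) u <= Ghat m q alpha W u.

Definition random_set {d : measure_display} {T : measurableType d}
    (I : finType) (S : T -> {set I}) : Prop :=
  forall j : I, measurable [set x | j \in S x].

Definition random_weights {d : measure_display} {T : measurableType d}
    {R : realType} (G : nat) (W : T -> R -> 'I_G -> R) : Prop :=
  forall (u : R) (g : 'I_G), 0 <= u <= 1 ->
    measurable_fun setT (fun x => W x u g).

Definition FDR {d : measure_display} {T : measurableType d} {R : realType}
    (P : probability T R) (I : finType) (H0 : {set I}) (S : T -> {set I}) :
    \bar R :=
  'E_P[fun x => #|S x :&: H0|%:R / (maxn #|S x| 1)%:R].

(* Main.v *)
Require Import Defs.
From HB Require Import structures.
From mathcomp Require Import all_boot all_order all_algebra.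
From mathcomp Require Import all_classical all_reals all_analysis.
From mathcomp Require Import measurable_realfun ring lra.
Import Order.TTheory GRing.Theory Num.Theory.
Import numFieldNormedType.Exports.

Set Implicit Arguments.
Unset Strict Implicit.
Unset Printing Implicit Defensive.

Local Open Scope classical_set_scope.
Local Open Scope ring_scope.

(* Substituting x_g = min(alpha u w_g, 1), maximizing the limit of Ghat at u over
   the weights becomes maximizing the strictly concave function
   sum_g D_g(x_g), D_g(t) = pi_g (pi_{g,0} U(t) + pi_{g,1} F_g(t)), over x in
   [0,1]^G under the budget sum_g pi_g pibar_{g,0} x_g <= alpha u. Its maximum
   V(alpha u) is concave in u, so V(alpha u) - u is positive below some u0 and
   negative above it, with u0 > 0 because alpha exceeds the critical level; by
   strict concavity the maximizer x0 at u0 is unique. Uniform convergence of the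
   empirical c.d.f.s then forces the crossing point to tend to u0, the fraction
   of rejections to V(alpha u0) = u0 and the rejection thresholds (truncated at
   1) to x0, so the FDR tends to l = sum_g pi_g pi_{g,0} x0_g / u0. The budget
   gives l <= alpha; it is exhausted when alpha <= pibar_0, whence the equality. *)

Lemma cvg_eq_near {R : realType} {Z : Type} (FZ : set_system Z)
    {FF : Filter FZ} (f g : Z -> R) (l : R) :
  (\forall z \near FZ, g z = f z) -> g z @[z --> FZ] --> l ->
  f z @[z --> FZ] --> l.
Proof. by move=> gf; apply: cvg_trans; apply: near_eq_cvg. Qed.

Lemma cvg_finsum {R : realType} {Z : Type} (F : set_system Z) {FF : Filter F}
    (I : finType) (f : I -> Z -> R) (l : I -> R) :
  (forall i, f i z @[z --> F] --> l i) ->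
  \sum_i f i z @[z --> F] --> \sum_i l i.
Proof.
move=> fl; apply: (@cvg_big _ _ +%R 0) => [|i _].
  exact: add_continuous.
exact: fl.
Qed.

(** * The limiting optimization problem *)

Section WeightedBudget.
Variables (R : realType) (G : nat) (D : 'I_G -> R -> R) (c : 'I_G -> R).
Hypothesis D0 : forall g, D g 0 = 0.
Hypothesis D_mono : forall g s t, s <= t -> D g s <= D g t.
Hypothesis D_cont : forall g, continuous (D g).
Hypothesis D_concave : forall g, strictly_concave01 (D g).
Hypothesis D_sat : forall g t, 1 <= t -> D g t = D g 1.
Hypothesis D_total : \sum_g D g 1 = 1.
Hypothesis c_gt0 : forall g, 0 < c g.

Implicit Types (x y : 'I_G -> R) (b : R).

(* The coordinate x_g stands for the truncated threshold min(alpha u w_g, 1). *)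
Definition obj x : R := \sum_g D g (x g).
Definition cost x : R := \sum_g c g * x g.
Definition feas b : set ('I_G -> R) :=
  [set x | (forall g, 0 <= x g <= 1) /\ cost x <= b].

Lemma concave01W g s t (l : R) : 0 <= s <= 1 -> 0 <= t <= 1 -> 0 <= l <= 1 ->
  l * D g s + (1 - l) * D g t <= D g (l * s + (1 - l) * t).
Proof.
move=> s01 t01 /andP[l0 l1].
have [->|lN0] := eqVneq l 0; first by rewrite !mul0r !subr0 !mul1r !add0r.
have [->|lN1] := eqVneq l 1; first by rewrite !subrr !mul0r !mul1r !addr0.
have [->|st] := eqVneq s t.
  by rewrite -!mulrDl subrKC !mul1r.
by apply/ltW/D_concave => //; rewrite !lt_neqAle eq_sym lN0 l0 lN1 l1.
Qed.

Lemma obj_continuous : continuous (obj : {ptws 'I_G -> R} -> R).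
Proof.
move=> x; apply: (@cvg_finsum _ _ (nbhs x) _ _ (fun g y => D g (y g))) => g.
apply: (continuous_comp (@proj_continuous _ (fun=> R) g x)); exact: D_cont.
Qed.

Lemma cost_continuous : continuous (cost : {ptws 'I_G -> R} -> R).
Proof.
move=> x; apply: (@cvg_finsum _ _ (nbhs x) _ _ (fun g y => c g * y g)) => g.
apply: cvgM; [exact: cvg_cst|exact: (@proj_continuous _ (fun=> R) g x)].
Qed.

(** With the topology of pointwise convergence the cube is compact by Tychonoff, and the budget cuts
    out a closed subset of it. *)
Lemma feas_compact b : compact (feas b : set {ptws 'I_G -> R}).
Proof.
have -> : feas b = [set x | forall g, `[0, 1]%classic (x g)] `&`
                   (cost @^-1` [set r | r <= b]).
  apply/seteqP; split => x [/= x01 xb]; split => // g;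
  by have := x01 g; rewrite /= in_itv.
apply: compact_closedI.
  exact: (@tychonoff _ (fun=> R) (fun=> `[0, 1]%classic)
    (fun=> @segment_compact R 0 1)).
by apply: preimage_closed => [x _|]; [exact: cost_continuous|exact: closed_le].
Qed.

Lemma max_on_compact (A : set {ptws 'I_G -> R}) : A !=set0 -> compact A ->
  exists2 x, A x & forall y, A y -> obj y <= obj x.
Proof.
move=> A0 cA; have [|x] := compact_EVT_max A0 cA (f := obj : {ptws 'I_G -> R} -> R).
  by apply: continuous_subspaceT; exact: obj_continuous.
by rewrite inE => Ax xmax; exists x => // y Ay; apply: xmax; rewrite inE.
Qed.

Lemma feas0 b : 0 <= b -> feas b (fun=> 0).
Proof.
by move=> b0; split => [g|]; rewrite ?lexx ?ler01// /cost big1// => g _; rewrite mulr0.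
Qed.

(** The condition [0 <= b] sits under the quantifier so that [opt] can be chosen as a total function
    of [b]. *)
Lemma maximizer_ex b :
  exists x, 0 <= b -> feas b x /\ forall y, feas b y -> obj y <= obj x.
Proof.
have [b0|_] := boolP (0 <= b); last by exists (fun=> 0).
have [x fx xmax] := max_on_compact (ex_intro _ _ (feas0 b0)) (@feas_compact b).
by exists x.
Qed.

Definition opt b : 'I_G -> R := projT1 (cid (maximizer_ex b)).
Definition maxobj b : R := obj (opt b).

Lemma opt_feas b : 0 <= b -> feas b (opt b).
Proof. by rewrite /opt; case: cid => x /= h /h[]. Qed.

Lemma maxobj_max b x : 0 <= b -> feas b x -> obj x <= maxobj b.
Proof. by rewrite /maxobj /opt; case: cid => y /= h /h[_]; exact. Qed.

Lemma obj_le1 x : obj x <= 1.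
Proof.
rewrite -D_total; apply: ler_sum => g _.
have [xg|/ltW xg] := leP (x g) 1; first exact: D_mono.
by rewrite D_sat.
Qed.

Lemma feas_ge0 b x : feas b x -> 0 <= b.
Proof.
move=> [x01]; apply: le_trans; apply: sumr_ge0 => g _.
by rewrite mulr_ge0 ?(ltW (c_gt0 g))//; case/andP: (x01 g).
Qed.

Lemma maxobj_le1 b : maxobj b <= 1. Proof. exact: obj_le1. Qed.

Lemma maxobj_mono b b' : 0 <= b -> b <= b' -> maxobj b <= maxobj b'.
Proof.
move=> b0 bb'; apply: maxobj_max; first exact: le_trans bb'.
by have [? h] := opt_feas b0; split => //; exact: le_trans bb'.
Qed.

Lemma feas_mix b b' x y (l : R) : 0 <= l <= 1 -> feas b x -> feas b' y ->
  feas (l * b + (1 - l) * b') (fun g => l * x g + (1 - l) * y g).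
Proof.
move=> /andP[l0 l1] [x01 xb] [y01 yb]; split.
  by move=> g; have := x01 g; have := y01 g; nra.
rewrite (_ : cost _ = l * cost x + (1 - l) * cost y).
  by apply: lerD; apply: ler_wpM2l => //; rewrite subr_ge0.
rewrite /cost !mulr_sumr -big_split; apply: eq_bigr => g _ /=; ring.
Qed.

Lemma obj_mix b b' x y (l : R) : 0 <= l <= 1 -> feas b x -> feas b' y ->
  l * obj x + (1 - l) * obj y <= obj (fun g => l * x g + (1 - l) * y g).
Proof.
move=> l01 [x01 _] [y01 _]; rewrite /obj !mulr_sumr -big_split.
by apply: ler_sum => g _; exact: concave01W.
Qed.

(** The mixture of the two maximizers respects the mixed budget. *)
Lemma maxobj_concave b b' (l : R) : 0 <= l <= 1 -> 0 <= b -> 0 <= b' ->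
  l * maxobj b + (1 - l) * maxobj b' <= maxobj (l * b + (1 - l) * b').
Proof.
move=> l01 b0 b'0; have fb := opt_feas b0; have fb' := opt_feas b'0.
apply: le_trans (obj_mix l01 fb fb') _; apply: maxobj_max; last exact: feas_mix.
exact: feas_ge0 (feas_mix l01 fb fb').
Qed.

(** Were [x] to differ from [opt b] at some [g0], their midpoint would be feasible and, by strict
    concavity of [D g0], better than both. *)
Lemma opt_unique b x : 0 <= b -> feas b x -> maxobj b <= obj x -> x = opt b.
Proof.
move=> b0 fx vx; apply: contrapT => xNo.
have /existsNP[g0 /eqP xg0] : ~ (forall g, x g = opt b g).
  by move=> h; apply: xNo; apply/funext.
have h01 : 0 <= (2^-1 : R) <= 1 by lra.
have fo := opt_feas b0; have fm := feas_mix h01 fx fo.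
have := maxobj_max (feas_ge0 fm) fm.
rewrite -mulrDl subrKC mul1r; apply/negP; rewrite -ltNge.
apply: (@le_lt_trans _ _ (2^-1 * obj x + (1 - 2^-1) * maxobj b)); first by lra.
rewrite /maxobj /obj !mulr_sumr -big_split (bigD1 g0)//= [ltRHS](bigD1 g0)//=.
have [x01 _] := fx; have [y01 _] := fo.
apply: ltr_leD; last by apply: ler_sum => g _; exact: concave01W.
by apply: D_concave => //; lra.
Qed.

(* On the compact set of feasible points at distance at least [r] from the
   maximizer, the objective has a strictly smaller maximum. *)
Lemma opt_stable b (r : R) : 0 <= b -> 0 < r ->
  exists2 k : R, 0 < k & forall x, feas b x -> maxobj b - k <= obj x ->
    forall g, `|x g - opt b g| <= r.
Proof.
move=> b0 r0.
have H g : exists k : R, 0 < k /\ forall x, feas b x -> maxobj b - k <= obj x ->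
    `|x g - opt b g| <= r.
  pose A : set {ptws 'I_G -> R} :=
    feas b `&` ((fun x => `|x g - opt b g|) @^-1` [set s | r <= s]).
  have cA : compact A.
    apply: compact_closedI; first exact: feas_compact.
    apply: preimage_closed => [x _|]; last exact: closed_ge.
    apply: (@continuous_comp _ _ _ _ (fun s : R => `|s - opt b g|) x
      (@proj_continuous _ (fun=> R) g x)).
    by apply: cvg_norm; apply: cvgB; [exact: cvg_id|exact: cvg_cst].
  have [A0|/eqP/set0P A0] := pselect (A = set0).
    exists 1; split=> // x fx _; rewrite leNgt; apply/negP => /ltW h.
    by have : A x by []; rewrite A0.
  have [y [fy yr] ymax] := @max_on_compact A A0 cA.
  have yb : obj y < maxobj b.
    rewrite ltNge; apply/negP => /(opt_unique b0 fy) yE.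
    by move: yr; rewrite yE /= subrr normr0 leNgt r0.
  exists ((maxobj b - obj y) / 2); split=> [|x fx xk].
    by rewrite divr_gt0 ?subr_gt0.
  rewrite leNgt; apply/negP => /ltW xr.
  by have := ymax x (conj fx xr); lra.
have [k kP] := choice H.
exists (\big[Num.min/1]_g k g) => [|x fx xk g].
  by apply: lt_bigmin => // g _; have [] := kP g.
have [_ h] := kP g; apply: h => //; apply: le_trans xk.
by rewrite lerD2l lerN2 bigmin_le.
Qed.
(** Strict concavity at the midpoint of [s] and 1, with monotonicity, gives [D g s < D g 1]; then
    [t] is a convex combination of [s] and 1. *)
Lemma D_strict_mono g s t : 0 <= s -> s < t -> t <= 1 -> D g s < D g t.
Proof.
move=> s0 st t1; have h01 : 0 < (2^-1 : R) < 1 by lra.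
have s1 : s < 1 := lt_le_trans st t1.
have D1 : D g s < D g 1.
  have := @D_concave g s 1 2^-1; rewrite !(ltW s1) s0 lexx ler01 lt_eqF// h01.
  move=> /(_ isT isT isT isT); have : D g (2^-1 * s + (1 - 2^-1) * 1) <= D g 1.
    by apply: D_mono; lra.
  by lra.
have [->//|tN1] := eqVneq t 1.
have tlt1 : t < 1 by rewrite lt_neqAle tN1.
pose l := (1 - t) / (1 - s).
have s1' : 0 < 1 - s by rewrite subr_gt0.
have l01 : 0 < l < 1.
  by rewrite divr_gt0 ?subr_gt0//= /l ltr_pdivrMr// mul1r; lra.
have tE : l * s + (1 - l) * 1 = t by rewrite /l; field; rewrite gt_eqF.
have := @D_concave g s 1 l; rewrite tE !(ltW s1) s0 lexx ler01 lt_eqF// l01.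
by move=> /(_ isT isT isT isT); nra.
Qed.

(** Unspent budget would leave some coordinate below 1, since filling all of them costs at least
    [b]; raising that coordinate would improve the objective. *)
Lemma opt_exhausts b : 0 <= b -> b <= \sum_g c g -> cost (opt b) = b.
Proof.
move=> b0 bc; have [x01 xb] := opt_feas b0; set x := opt b in x01 xb *.
apply/eqP; rewrite eq_le xb leNgt; apply/negP => xltb.
have /existsNP[g /negP] : ~ (forall g, 1 <= x g).
  move=> x1; move: xltb; rewrite ltNge => /negP; apply.
  apply: le_trans bc _; apply: ler_sum => g _.
  by rewrite ler_peMr// ltW.
rewrite -ltNge => xg1.
(* The largest increase of coordinate [g] that respects both the bound 1 and the budget. *)
pose e := Num.min (1 - x g) ((b - cost x) / c g).
have e0 : 0 < e by rewrite lt_min subr_gt0 xg1 divr_gt0// subr_gt0.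
have e1 : e <= 1 - x g by rewrite ge_min lexx.
have e2 : c g * e <= b - cost x.
  by rewrite mulrC -ler_pdivlMr// ge_min lexx orbT.
pose y h := if h == g then x g + e else x h.
have fy : feas b y.
  split=> [h|]; first by rewrite /y; have := x01 g; case: eqP => //= _; lra.
  have -> : cost y = cost x + c g * e.
    rewrite /cost (bigD1 g)//= [in RHS](bigD1 g)//= {1}/y eqxx.
    rewrite (eq_bigr (fun h => c h * x h)); first by ring.
    by move=> h /negPf hg; rewrite /y hg.
  by rewrite -lerBrDl.
have := maxobj_max b0 fy; rewrite leNgt => /negP; apply.
rewrite /maxobj /obj -/x (bigD1 g)//= [ltRHS](bigD1 g)//= {1}/y eqxx.
rewrite (eq_bigr (fun h => D h (y h))) => [|h /negPf hg]; last by rewrite /y hg.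
by rewrite ltrD2r; apply: D_strict_mono; have := x01 g; lra.
Qed.

Lemma feas_le0 b x g : b <= 0 -> feas b x -> x g = 0.
Proof.
move=> b0 [x01 xb]; have xh h : 0 <= c h * x h.
  by rewrite mulr_ge0 ?(ltW (c_gt0 _))//; case/andP: (x01 h).
apply/eqP; rewrite eq_le; case/andP: (x01 g) => -> _; rewrite andbT.
rewrite -(pmulr_rle0 _ (c_gt0 g)); apply: le_trans b0; apply: le_trans xb.
by rewrite /cost (bigD1 g)//= lerDl sumr_ge0.
Qed.

Lemma maxobj0 : maxobj 0 = 0.
Proof.
have f0 := opt_feas (lexx 0); rewrite /maxobj /obj big1// => g _.
by rewrite (feas_le0 g (lexx 0) f0) D0.
Qed.

(** * The limiting crossing point *)

Section FixedPoint.
Variable alpha : R.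
Hypothesis alpha_gt0 : 0 < alpha.
Hypothesis supercritical : exists u, [/\ 0 < u, u <= 1 & u < maxobj (alpha * u)].

Let alphaM u : 0 <= u -> 0 <= alpha * u.
Proof. by move=> u0; rewrite mulr_ge0// ltW. Qed.

Definition ulim : R := crossing (fun u => maxobj (alpha * u)).

Let S : set R := [set u | 0 <= u <= 1 /\ u <= maxobj (alpha * u)].

Let S_has_sup : has_sup S.
Proof.
split; last by exists 1 => u [/andP[]].
by have [u [u0 u1 /ltW h]] := supercritical; exists u; rewrite /S /= (ltW u0) u1.
Qed.

Lemma ulim_gt0 : 0 < ulim.
Proof.
have [u [u0 u1 /ltW h]] := supercritical; apply: (lt_le_trans u0).
by apply: (ub_le_sup S_has_sup.2); rewrite /S /= (ltW u0) u1.
Qed.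

Lemma ulim_le1 : ulim <= 1.
Proof. by apply: sup_le_ub => [|u [/andP[]]]//; case: S_has_sup. Qed.

Lemma maxobj_gt_ulim u : ulim < u -> u <= 1 -> maxobj (alpha * u) < u.
Proof.
move=> ulu u1; rewrite ltNge; apply/negP => h.
have := ulu; rewrite ltNge => /negP; apply; apply: (ub_le_sup S_has_sup.2).
by split=> //; rewrite u1 (le_trans (ltW ulim_gt0) (ltW ulu)).
Qed.

(** Concavity and [maxobj 0 = 0] make [maxobj (alpha * u) / u] nonincreasing; the product form also
    covers [u = 0]. *)
Lemma maxobj_ratio u v : 0 < v -> 0 <= u <= v ->
  u * maxobj (alpha * v) <= v * maxobj (alpha * u).
Proof.
move=> v0 /andP[u0 uv].
have vE : v * (u / v) = u by rewrite mulrC divfK ?gt_eqF.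
have l01 : 0 <= u / v <= 1.
  by rewrite divr_ge0 ?(ltW v0)//= ler_pdivrMr// mul1r.
have := maxobj_concave l01 (alphaM (ltW v0)) (lexx 0).
rewrite maxobj0 !mulr0 !addr0 mulrCA [u / v * v]mulrC vE => h.
by rewrite -{1}vE -mulrA ler_pM2l.
Qed.

(** At [ulim] the inequality passes to the supremum by monotonicity. Below it, some [v > u]
    satisfies the inequality and [maxobj_ratio] carries it down to [u]. *)
Lemma maxobj_le_ulim u : 0 <= u <= ulim -> u <= maxobj (alpha * u).
Proof.
move=> /andP[u0]; rewrite le_eqVlt => /predU1P[uE|ultl].
  rewrite {1}uE; apply: sup_le_ub => [|v [/andP[v0 v1] vS]].
    by case: S_has_sup.
  apply: (le_trans vS); apply: maxobj_mono; first exact: alphaM.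
  rewrite ler_pM2l// uE; apply: (ub_le_sup S_has_sup.2).
  by split=> //; rewrite v0.
have : 0 < ulim - u by rewrite subr_gt0.
move=> /sup_adherent/(_ S_has_sup)[v [/andP[v0 v1] vS]]; rewrite subKr => uv.
have v0' : 0 < v := le_lt_trans u0 uv.
rewrite -(ler_pM2l v0'); apply: (le_trans _ (maxobj_ratio v0' _)); last first.
  by rewrite u0 ltW.
by rewrite mulrC ler_wpM2l.
Qed.

(** Strictness spreads from the supercritical point [v]: to its left by [maxobj_ratio], to its right
    because [u] mixes [v] and [ulim] with positive weight on [v]. *)
Lemma maxobj_lt_ulim u : 0 < u < ulim -> u < maxobj (alpha * u).
Proof.
move=> /andP[u0 ul]; have [v [v0 v1 vv]] := supercritical.
have [uv|vu] := ltP u v.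
  have uv' : 0 <= u <= v by rewrite !ltW.
  have h := maxobj_ratio v0 uv'.
  rewrite -(ltr_pM2l v0); apply: lt_le_trans h.
  by rewrite mulrC ltr_pM2l.
have vl : 0 < ulim - v by rewrite subr_gt0 (le_lt_trans vu).
pose l := (ulim - u) / (ulim - v).
have l0 : 0 < l by rewrite /l divr_gt0// subr_gt0.
have l1 : l <= 1 by rewrite /l ler_pdivrMr// mul1r lerD2l lerN2.
have uE : l * v + (1 - l) * ulim = u by rewrite /l; field; rewrite gt_eqF.
have l01 : 0 <= l <= 1 by rewrite ltW.
have := maxobj_concave l01 (alphaM (ltW v0)) (alphaM (ltW ulim_gt0)).
rewrite (_ : _ + (1 - l) * (alpha * ulim) = alpha * u); last by rewrite -uE; ring.
have : ulim <= maxobj (alpha * ulim).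
  by apply: maxobj_le_ulim; rewrite lexx ltW ?ulim_gt0.
by nra.
Qed.

(** If the value exceeded [ulim < 1], that value capped at 1 would, by monotonicity, be a point
    beyond [ulim] still satisfying the defining inequality. *)
Lemma maxobj_ulim : maxobj (alpha * ulim) = ulim.
Proof.
apply/eqP; rewrite eq_le; apply/andP; split; last first.
  by apply: maxobj_le_ulim; rewrite lexx ltW ?ulim_gt0.
have [ul1|ul1] := leP 1 ulim; first exact: le_trans (maxobj_le1 _) ul1.
rewrite leNgt; apply/negP => h.
pose v := Num.min (maxobj (alpha * ulim)) 1.
have ulv : ulim < v by rewrite lt_min h.
have v1 : v <= 1 by rewrite ge_min lexx orbT.
have := maxobj_gt_ulim ulv v1; rewrite ltNge => /negP; apply.
apply: (@le_trans _ _ (maxobj (alpha * ulim))); first by rewrite ge_min lexx.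
by rewrite maxobj_mono ?alphaM ?(ltW ulim_gt0)// ler_pM2l// ltW.
Qed.

(** By [maxobj_ratio] the gap [u - maxobj (alpha * u)] is smallest at [u = v]. *)
Lemma maxobj_gap v : ulim < v ->
  exists2 k, 0 < k & forall u, v <= u -> u <= 1 -> maxobj (alpha * u) <= u - k.
Proof.
move=> ulv; have [v1|v1] := leP v 1; last first.
  by exists 1 => // u vu /(le_trans vu); rewrite leNgt v1.
have kv := maxobj_gt_ulim ulv v1.
exists (v - maxobj (alpha * v)); first by rewrite subr_gt0.
move=> u vu u1; have v0 : 0 < v := lt_trans ulim_gt0 ulv.
have u0 : 0 < u := lt_le_trans v0 vu.
have vu' : 0 <= v <= u by rewrite ltW.
have h := maxobj_ratio u0 vu'; rewrite -(ler_pM2l v0); apply: (le_trans h).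
have : 0 <= (u - v) * (v - maxobj (alpha * v)).
  by rewrite mulr_ge0 ?subr_ge0// ltW.
by lra.
Qed.

(** On either side of [ulim], the value [maxobj (alpha * u)] lies between [u] and [ulim]. *)
Lemma maxobj_dist_ulim u : 0 <= u <= 1 -> `|maxobj (alpha * u) - ulim| <= `|u - ulim|.
Proof.
move=> /andP[u0 u1]; have [ul|ul] := leP u ulim.
  have h1 : u <= maxobj (alpha * u) by rewrite maxobj_le_ulim// u0.
  have h2 : maxobj (alpha * u) <= ulim.
    by rewrite -[leRHS]maxobj_ulim maxobj_mono ?alphaM// ler_pM2l.
  by rewrite !ler0_norm ?subr_le0// lerN2 lerD2r.
have h1 := ltW (maxobj_gt_ulim ul u1).
have h2 : ulim <= maxobj (alpha * u).
  by rewrite -[leLHS]maxobj_ulim maxobj_mono ?alphaM// ?(ltW ulim_gt0)// ler_pM2l// ltW.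
by rewrite !ger0_norm ?subr_ge0// ?lerD2r// ltW.
Qed.

(** * Convergence along a filter *)

Section Convergence.
Variables (Z : Type) (FZ : set_system Z).
Context {FF : Filter FZ}.
Variables (B : 'I_G -> Z -> R -> R) (chat : 'I_G -> Z -> R).
Variable W : Z -> R -> 'I_G -> R.
Hypothesis B_unif : forall e, 0 < e ->
  \forall z \near FZ, forall g t, 0 <= t -> `|B g z t - D g t| <= e.
Hypothesis chat_cvg : forall g, chat g z @[z --> FZ] --> c g.

(** An abstract [Ghat] at a constant weight. With [B] and the filter left general, the argument
    below is deterministic; probability enters only through the choice of filter. *)
Definition Gemp (z : Z) (w : 'I_G -> R) (u : R) : R :=
  \sum_g B g z (alpha * u * w g).

Hypothesis W_opt : forall z u, 0 <= u <= 1 ->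
  [/\ forall g, 0 <= W z u g, \sum_g chat g z * W z u g <= 1
    & forall w, (forall g, 0 <= w g) -> \sum_g chat g z * w g <= 1 ->
        Gemp z w u <= Gemp z (W z u) u].

Let Gmax z u := Gemp z (W z u) u.
Let uhat z := crossing (Gmax z).
Let thr z u g := Num.min (alpha * u * W z u g) 1.

Lemma Gemp_close e : 0 < e ->
  \forall z \near FZ, forall w u, 0 <= u -> (forall g, 0 <= w g) ->
    `|Gemp z w u - \sum_g D g (alpha * u * w g)| <= e.
Proof.
(* Dividing by [G.+1] keeps the denominator positive and leaves the sum of [G] errors below [e]. *)
move=> e0; have e0' : 0 < e / G.+1%:R by rewrite divr_gt0.
apply: filterS (B_unif e0') => z hz w u u0 w0.
rewrite /Gemp -sumrB; apply: le_trans (ler_norm_sum _ _ _) _.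
apply: (@le_trans _ _ (\sum_(g < G) e / G.+1%:R)).
  by apply: ler_sum => g _; apply: hz; rewrite mulr_ge0 ?alphaM.
rewrite sumr_const card_ord -[leLHS]mulr_natr mulrAC ler_pdivrMr// ler_pM2l//.
by rewrite ler_nat leqnSn.
Qed.

Lemma obj_thr z u : obj (thr z u) = \sum_g D g (alpha * u * W z u g).
Proof.
apply: eq_bigr => g _; rewrite /thr.
by have [//|/ltW h] := leP (alpha * u * W z u g) 1; rewrite [RHS]D_sat.
Qed.

Lemma thr01 z u g : 0 <= u <= 1 -> 0 <= thr z u g <= 1.
Proof.
move=> u01; have [w0 _ _] := W_opt z u01; have /andP[u0 _] := u01.
by rewrite /thr ge_min lexx orbT andbT le_min ler01 mulr_ge0 ?alphaM.
Qed.

Lemma feas_scale b b' x l : 0 <= l <= 1 -> (forall g, 0 <= x g <= 1) ->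
  l * cost x <= b -> feas b (fun g => l * x g).
Proof.
move=> /andP[l0 l1] x01 xb; split=> [g|]; first by have := x01 g; nra.
rewrite (_ : cost _ = l * cost x)// /cost mulr_sumr.
by apply: eq_bigr => g _; rewrite mulrCA.
Qed.

Lemma obj_scale x l : 0 <= l <= 1 -> (forall g, 0 <= x g <= 1) ->
  l * obj x <= obj (fun g => l * x g).
Proof.
move=> l01 x01; rewrite /obj mulr_sumr; apply: ler_sum => g _.
have := @concave01W g (x g) 0 l (x01 g) _ l01; rewrite lexx ler01 D0 !mulr0 !addr0.
exact.
Qed.

(** The empirical and limiting budgets have different coefficients. Shrinking by a factor [l] close
    to 1 makes a point of one problem feasible for the other, and concavity bounds the loss by that
    factor. *)
Lemma Gmax_unif e : 0 < e ->
  \forall z \near FZ, forall u, 0 <= u <= 1 -> `|Gmax z u - maxobj (alpha * u)| <= e.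
Proof.
(* Chosen so that both [1 - l] and [l^-1 - 1] are at most [e / 2]; the other [e / 2] pays for
   [Gemp_close]. *)
move=> e0; pose l := (1 + e / 2)^-1.
have e2 : 0 < e / 2 by lra.
have e1 : 0 < 1 + e / 2 by lra.
have l0 : 0 < l by rewrite invr_gt0.
have lE : l * (1 + e / 2) = 1 by rewrite mulVf// gt_eqF.
have l1 : l < 1 by nra.
have l01 : 0 <= l <= 1 by rewrite !ltW.
have c1 : \forall z \near FZ, forall g, l * chat g z < c g.
  apply: filter_forall => g; apply: (@cvgr_lt _ _ _ _ _ (l * c g)).
    by apply: cvgM; [exact: cvg_cst|exact: chat_cvg].
  by rewrite gtr_pMl.
have c2 : \forall z \near FZ, forall g, l * c g < chat g z.
  apply: filter_forall => g; apply: (cvgr_gt (c g) (chat_cvg (g:=g))).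
  by rewrite gtr_pMl.
near=> z => u u01; have /andP[u0 u1] := u01; have au0 := alphaM u0.
have hG : forall w u, 0 <= u -> (forall g, 0 <= w g) ->
    `|Gemp z w u - \sum_g D g (alpha * u * w g)| <= e / 2.
  by near: z; exact: Gemp_close.
have hc1 : forall g, l * chat g z < c g by near: z.
have hc2 : forall g, l * c g < chat g z by near: z.
have [W0 W1 Wmax] := W_opt z u01.
rewrite ler_distl; apply/andP; split.
- have [x01 xb] := opt_feas au0; set x := opt (alpha * u) in x01 xb.
  (* The weights with thresholds [l * x g]. If [alpha * u] is 0 the quotient is 0, and so is [x g]
     under a null budget. *)
  pose w g := l * x g / (alpha * u).
  have w0 g : 0 <= w g.
    by rewrite /w divr_ge0// mulr_ge0 ?(ltW l0)//; case/andP: (x01 g).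
  have wE g : alpha * u * w g = l * x g.
    have [au|auN0] := eqVneq (alpha * u) 0; last by rewrite /w mulrC divfK.
    by rewrite au mul0r (@feas_le0 (alpha * u) x g) ?mulr0// au.
  have w1 : \sum_g chat g z * w g <= 1.
    have [au|auN0] := eqVneq (alpha * u) 0.
      by rewrite big1 ?ler01// => g _; rewrite /w au invr0 !mulr0.
    have au1 : 0 < alpha * u by rewrite lt_neqAle eq_sym auN0.
    rewrite /w (eq_bigr (fun g => (l * chat g z * x g) / (alpha * u))); last first.
      by move=> g _; ring.
    rewrite -mulr_suml ler_pdivrMr// mul1r; apply: le_trans xb.
    apply: ler_sum => g _; apply: ler_wpM2r; first by case/andP: (x01 g).
    exact: ltW.
  have := hG w u u0 w0; rewrite ler_distl => /andP[h _].
  rewrite (eq_bigr (fun g => D g (l * x g))) in h; last by move=> g _; rewrite wE.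
  have h2 := obj_scale l01 x01; have h3 := Wmax w w0 w1.
  have : maxobj (alpha * u) - (1 - l) <= l * maxobj (alpha * u).
    by have := maxobj_le1 (alpha * u); nra.
  have : 1 - l <= e / 2 by nra.
  rewrite /Gmax; move: h2 h3 h; rewrite -/(maxobj _) /obj; lra.
(* Conversely, the truncated thresholds of [W], shrunk by [l], are feasible for the limiting
   problem. *)
- have := hG _ u u0 W0; rewrite ler_distl -obj_thr => /andP[_ h].
  have t01 g : 0 <= thr z u g <= 1 by exact: thr01.
  have fy : feas (alpha * u) (fun g => l * thr z u g).
    apply: feas_scale => //.
    apply: (@le_trans _ _ (\sum_g chat g z * (alpha * u * W z u g))).
      rewrite /cost mulr_sumr; apply: ler_sum => g _; rewrite [leLHS]mulrA.
      apply: ler_pM.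
      - by rewrite mulr_ge0 ?(ltW l0) ?(ltW (c_gt0 g)).
      - by case/andP: (t01 g).
      - exact: ltW.
      - by rewrite /thr ge_min lexx.
    rewrite (eq_bigr (fun g => alpha * u * (chat g z * W z u g))) => [|g _];
      last by ring.
    by rewrite -mulr_sumr ler_piMr.
  have h2 := obj_scale l01 t01; have h3 := maxobj_max au0 fy.
  have h4 := maxobj_le1 (alpha * u).
  have h5 : obj (thr z u) <= maxobj (alpha * u) * (1 + e / 2).
    rewrite -(ler_pM2l l0) mulrCA lE mulr1; exact: le_trans h2 h3.
  by rewrite /Gmax; nra.
Unshelve. all: end_near. Qed.

(** Uniform closeness keeps a point just below [ulim] in the set defining [uhat z], and excludes
    every point beyond [ulim + e]. *)
Lemma uhat_near e : 0 < e ->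
  \forall z \near FZ, 0 <= uhat z <= 1 /\ `|ulim - uhat z| <= e.
Proof.
(* The bound [ulim / 2] keeps [v] positive, as the strict inequality at [v] requires. *)
move=> e0; pose v := Num.max (ulim - e) (ulim / 2).
have ul0 := ulim_gt0; have ul1 := ulim_le1.
have v0 : 0 < v by rewrite lt_max divr_gt0 ?orbT.
have vul : v < ulim by rewrite gt_max; lra.
have v1 : 0 < v < ulim by rewrite v0.
have k1 := maxobj_lt_ulim v1.
have [k k0 kP] := @maxobj_gap (ulim + e) (ltr_pwDr e0 (lexx _)).
pose r := Num.min (maxobj (alpha * v) - v) (k / 2).
have r0 : 0 < r by rewrite lt_min subr_gt0 k1 divr_gt0.
apply: filterS (Gmax_unif r0) => z hz.
have hS : has_ubound [set u | 0 <= u <= 1 /\ u <= Gmax z u].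
  by exists 1 => u [/andP[]].
have Sv : [set u | 0 <= u <= 1 /\ u <= Gmax z u] v.
  have v01 : 0 <= v <= 1 by rewrite (ltW v0) (le_trans (ltW vul)).
  split=> //; have := hz v v01; rewrite ler_distl => /andP[h _].
  have : r <= maxobj (alpha * v) - v by rewrite ge_min lexx.
  by lra.
have vu : v <= uhat z by exact: ub_le_sup hS _ Sv.
have u1 : uhat z <= 1.
  by apply: sup_le_ub => [|u [/andP[]]//]; exists v.
have uu : uhat z <= ulim + e.
  apply: sup_le_ub => [|u [u01 uS]]; first by exists v.
  rewrite leNgt; apply/negP => ueu; have /andP[_ u1'] := u01.
  have := kP u (ltW ueu) u1'; have := hz u u01; rewrite ler_distl => /andP[_ h].
  have : r <= k / 2 by rewrite ge_min lexx orbT.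
  by lra.
have : ulim - e <= v by rewrite le_max lexx.
by rewrite ler_distl => h; split; apply/andP; split; lra.
Qed.

Lemma uhat_cvg : uhat z @[z --> FZ] --> ulim.
Proof.
by apply/cvgrPdist_le => e /uhat_near; apply: filterS => z [].
Qed.

Lemma uhat01 : \forall z \near FZ, 0 <= uhat z <= 1.
Proof. by apply: filterS (uhat_near ltr01) => z []. Qed.

Lemma Gmax_uhat_cvg : Gmax z (uhat z) @[z --> FZ] --> ulim.
Proof.
apply/cvgrPdist_le => e e0; have e2 : 0 < e / 2 by lra.
near=> z.
have hz : forall u, 0 <= u <= 1 -> `|Gmax z u - maxobj (alpha * u)| <= e / 2.
  by near: z; exact: Gmax_unif.
have [u01 hu] : 0 <= uhat z <= 1 /\ `|ulim - uhat z| <= e / 2.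
  by near: z; exact: uhat_near.
have := maxobj_dist_ulim u01; have := hz _ u01.
rewrite distrC in hu; rewrite [`|ulim - Gmax z _|]distrC.
have := ler_distD (maxobj (alpha * uhat z)) (Gmax z (uhat z)) ulim; lra.
Unshelve. all: end_near. Qed.

(** Slightly shrunk, the thresholds are feasible for the budget [alpha * ulim] and nearly optimal
    there, so [opt_stable] puts them close to the maximizer. *)
Lemma thr_cvg g : thr z (uhat z) g @[z --> FZ] --> opt (alpha * ulim) g.
Proof.
apply/cvgrPdist_le => e e0; have e2 : 0 < e / 2 by lra.
have b0 : 0 < alpha * ulim by rewrite mulr_gt0// ulim_gt0.
have [k k0 kP] := opt_stable (ltW b0) e2.
(* The bound [e / 2] limits the displacement due to shrinking, [k / 4] the loss of objective, and
   [1 / 2] keeps [l] positive. *)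
pose d := Num.min (Num.min (e / 2) (k / 4)) (1 / 2).
have d0 : 0 < d by rewrite !lt_min e2/= !divr_gt0.
have [de dk d1] : [/\ d <= e / 2, d <= k / 4 & d <= 1 / 2].
  by split; rewrite /d !ge_min lexx ?orbT.
pose l := 1 - d.
have l0 : 0 < l by rewrite /l; lra.
have l01 : 0 <= l <= 1 by rewrite /l; lra.
(* The left side will bound the limiting cost of the thresholds; it tends to [alpha * ulim],
   strictly below the right side. *)
have costP : \forall z \near FZ,
    (\sum_g `|c g - chat g z|) + alpha * uhat z < alpha * ulim / l.
  apply: (@cvgr_lt _ _ _ _ _ (\sum_(g < G) 0 + alpha * ulim)).
    apply: cvgD.
      apply: (@cvg_finsum _ _ _ _ _ (fun g z => `|c g - chat g z|) (fun=> 0)) => h.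
      rewrite -(normr0 R) -(subrr (c h)); apply: cvg_norm.
      by apply: cvgB; [exact: cvg_cst|exact: chat_cvg].
    by apply: cvgM; [exact: cvg_cst|exact: uhat_cvg].
  by rewrite big1// add0r ltr_pdivlMr// gtr_pMr// /l; lra.
have k4 : 0 < k / 4 by lra.
near=> z.
have u01 : 0 <= uhat z <= 1 by near: z; exact: uhat01.
have /andP[u0 _] := u01.
have t01 h : 0 <= thr z (uhat z) h <= 1 by exact: thr01.
have [W0 W1 _] := W_opt z u01.
have chpos : forall h, 0 < chat h z.
  near: z; apply: filter_forall => h.
  by apply: (cvgr_gt (c h) (chat_cvg (g:=h))); exact: c_gt0.
pose y h := l * thr z (uhat z) h.
have fy : feas (alpha * ulim) y.
  apply: feas_scale => //; rewrite mulrC -ler_pdivlMr//.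
  apply: (@le_trans _ _ ((\sum_g `|c g - chat g z|) + alpha * uhat z)); last first.
    by apply/ltW; near: z.
  apply: (@le_trans _ _ (\sum_g (`|c g - chat g z| +
      chat g z * (alpha * uhat z * W z (uhat z) g)))).
    apply: ler_sum => h _; have := t01 h => /andP[t0 t1].
    have ch0 : 0 < chat h z by [].
    apply: (@le_trans _ _ (`|c h - chat h z| * thr z (uhat z) h
        + chat h z * thr z (uhat z) h)).
      by rewrite -mulrDl ler_wpM2r// -lerBlDr ler_norm.
    apply: lerD; first by rewrite ler_piMr.
    by rewrite ler_pM2l// /thr ge_min lexx.
  rewrite big_split/= lerD2l.
  rewrite (eq_bigr (fun g => alpha * uhat z * (chat g z * W z (uhat z) g)))
    => [|h _]; last by ring.
  by rewrite -mulr_sumr ler_piMr ?alphaM.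
have oy : maxobj (alpha * ulim) - k <= obj y.
  have h1 := obj_scale l01 t01; rewrite -/y in h1.
  have h2 := obj_le1 (thr z (uhat z)).
  have h3 : obj (thr z (uhat z)) - d <= l * obj (thr z (uhat z)).
    by rewrite /l; nra.
  have : `|ulim - Gmax z (uhat z)| <= k / 4.
    by near: z; move/cvgrPdist_le : Gmax_uhat_cvg; apply.
  have : `|Gmax z (uhat z) - obj (thr z (uhat z))| <= k / 4.
    rewrite obj_thr; near: z; apply: filterS2 uhat01 (Gemp_close k4).
    move=> z u01' h; have [W0' _ _] := W_opt z u01'.
    by apply: h => //; case/andP: u01'.
  rewrite maxobj_ulim !ler_norml => /andP[_ h4] /andP[h5 h6]; lra.
have := kP y fy oy g; rewrite distrC => h.
have : `|y g - thr z (uhat z) g| <= d.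
  have /andP[t0 t1] := t01 g.
  by rewrite /y /l ler_norml; apply/andP; split; nra.
by move: h; have := ler_distD (y g) (opt (alpha * ulim) g) (thr z (uhat z) g); lra.
Unshelve. all: end_near. Qed.

(** Gives the limit of the false discovery proportion when [A] counts the true nulls below a
    threshold. Uniformity in [t] permits evaluating [A] at the random thresholds. *)
Lemma ratio_cvg (A : 'I_G -> Z -> R -> R) (k : 'I_G -> R) :
  (forall e, 0 < e -> \forall z \near FZ, forall g t, 0 <= t ->
     `|A g z t - k g * Num.min t 1| <= e) ->
  (\sum_g A g z (alpha * uhat z * W z (uhat z) g)) / Gmax z (uhat z)
    @[z --> FZ] --> (\sum_g k g * opt (alpha * ulim) g) / ulim.
Proof.
move=> A_unif; apply: cvgM; last first.
  by apply: cvgV; [rewrite gt_eqF// ulim_gt0|exact: Gmax_uhat_cvg].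
apply: (@cvg_finsum _ _ FZ _ _
  (fun g z => A g z (alpha * uhat z * W z (uhat z) g))) => g.
have kt : k g * thr z (uhat z) g @[z --> FZ] --> k g * opt (alpha * ulim) g.
  by apply: cvgM; [exact: cvg_cst|exact: thr_cvg].
apply/cvgrPdist_le => e e0; have e2 : 0 < e / 2 by lra.
near=> z.
have u01 : 0 <= uhat z <= 1 by near: z; exact: uhat01.
have [W0 _ _] := W_opt z u01; have /andP[u0 _] := u01.
have h1 : `|k g * opt (alpha * ulim) g - k g * thr z (uhat z) g| <= e / 2.
  by near: z; move/cvgrPdist_le : kt; apply.
have h2 : forall g t, 0 <= t -> `|A g z t - k g * Num.min t 1| <= e / 2.
  by near: z; exact: A_unif.
have := h2 g (alpha * uhat z * W z (uhat z) g); rewrite mulr_ge0 ?alphaM// => /(_ isT).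
rewrite distrC => h3.
apply: (le_trans (ler_distD (k g * thr z (uhat z) g) _ _)).
by rewrite [leRHS](splitr e) lerD.
Unshelve. all: end_near. Qed.

End Convergence.
End FixedPoint.
End WeightedBudget.

(** * Limiting and empirical distribution functions *)

(* Polya's theorem: by monotonicity, closeness at t - r and t + r controls all
   the points in between. *)
Lemma monotone_cvg_uniform {R : realType} {Z : Type} (FZ : set_system Z)
    {FF : Filter FZ} (f : R -> R) (h : Z -> R -> R) :
  continuous f -> (forall z s t, s <= t -> h z s <= h z t) ->
  (forall t, h z t @[z --> FZ] --> f t) ->
  (forall t, 1 <= t -> f t = f 1) -> (forall z t, 1 <= t -> h z t = h z 1) ->
  forall e, 0 < e -> \forall z \near FZ, forall t, 0 <= t -> `|h z t - f t| <= e.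
Proof.
move=> fc hm hf f1 h1 e e0.
have e4 : 0 < e / 4 by lra.
(* Compactness in its near-covering form: it is enough to control [s] near [t] and [z] jointly, for
   each [t]. *)
have : \near FZ, `[0, 1]%classic `<=` (fun t => `|h FZ t - f t| <= e).
  have /compact_near_coveringP := @segment_compact R 0 1.
  apply=> t _.
  have [r /= r0 rP] : exists2 r, 0 < r &
      forall s, `|t - s| < r -> `|f t - f s| <= e / 4.
    have /cvgrPdist_le/(_ _ e4)/nbhs_ballP[r r0 rP] := fc t.
    by exists r => // s; exact: rP.
  have r2 : 0 < r / 2 by lra.
  have n1 : \forall z \near FZ, `|f (t - r / 2) - h z (t - r / 2)| <= e / 4.
    by have /cvgrPdist_le := hf (t - r / 2); apply.
  have n2 : \forall z \near FZ, `|f (t + r / 2) - h z (t + r / 2)| <= e / 4.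
    by have /cvgrPdist_le := hf (t + r / 2); apply.
  have n3 : \forall s \near t, `|t - s| < r / 2.
    by apply/nbhs_ballP; exists (r / 2).
  near=> s z => /=.
  have k1 : `|f (t - r / 2) - h z (t - r / 2)| <= e / 4 by near: z.
  have k2 : `|f (t + r / 2) - h z (t + r / 2)| <= e / 4 by near: z.
  have k3 : `|t - s| < r / 2 by near: s.
  have m1 : h z (t - r / 2) <= h z s.
    by apply: hm; move: k3; rewrite ltr_norml => /andP[]; lra.
  have m2 : h z s <= h z (t + r / 2).
    by apply: hm; move: k3; rewrite ltr_norml => /andP[]; lra.
  have j1 : `|f t - f (t - r / 2)| <= e / 4.
    by apply: rP; rewrite opprB addrC subrK gtr0_norm//; lra.
  have j2 : `|f t - f (t + r / 2)| <= e / 4.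
    by apply: rP; rewrite opprD addNKr normrN gtr0_norm//; lra.
  have j3 : `|f t - f s| <= e / 4 by apply: rP; lra.
  move: k1 k2 j1 j2 j3; rewrite !ler_norml.
  by move=> /andP[? ?] /andP[? ?] /andP[? ?] /andP[? ?] /andP[? ?]; apply/andP;
    split; lra.
apply: filterS => z hz t t0; have [t1|/ltW t1] := leP t 1.
  by apply: hz; rewrite /= in_itv /= t0.
by rewrite h1// f1//; apply: hz; rewrite /= in_itv/= ler01 lexx.
Unshelve. all: end_near. Qed.

Section Ucdf.
Variable R : realType.
Implicit Types s t : R.

Lemma UcdfE t : Ucdf t = Num.max 0 (Num.min t 1).
Proof.
rewrite /Ucdf; have [t0|t0] := ltP 0 t; rewrite ?mul1r ?mul0r.
  by rewrite max_r// le_min (ltW t0) ler01.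
by rewrite max_l// ge_min t0.
Qed.

Lemma Ucdf_id t : 0 <= t <= 1 -> Ucdf t = t.
Proof. by move=> /andP[t0 t1]; rewrite UcdfE min_l// max_r. Qed.

Lemma Ucdf_min t : 0 <= t -> Ucdf t = Num.min t 1.
Proof. by move=> t0; rewrite UcdfE max_r// le_min t0 ler01. Qed.

Lemma Ucdf_sat t : 1 <= t -> Ucdf t = 1.
Proof. by move=> t1; rewrite UcdfE min_r// max_r. Qed.

Lemma Ucdf_le0 t : t <= 0 -> Ucdf t = 0.
Proof. by move=> t0; rewrite /Ucdf ltNge t0 mul0r. Qed.

Lemma Ucdf_mono s t : s <= t -> Ucdf s <= Ucdf t.
Proof.
move=> st; rewrite !UcdfE; have m1 : Num.max 0 1 = 1 :> R by rewrite max_r.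
by case: (leP s 1) => ?; case: (leP t 1) => ?; rewrite ?m1; case: (leP 0 s) => ?;
  case: (leP 0 t) => ?; lra.
Qed.

Lemma Ucdf_continuous : continuous (@Ucdf R).
Proof.
move=> t; rewrite (_ : Ucdf = (fun=> 0 : R^o) \max ((@id R^o) \min (fun=> 1 : R^o))).
  apply: continuous_max; first exact: cst_continuous.
  by apply: continuous_min; [exact: cvg_id|exact: cst_continuous].
by apply/funext => s; rewrite UcdfE.
Qed.
End Ucdf.

(** Concavity against the origin: [s] is the mixture of [t] and 0 with weight [s / t]. *)
Lemma concave01_ratio {R : realType} (F : R -> R) (s t : R) :
  strictly_concave01 F -> F 0 = 0 -> 0 < s -> s <= t -> t <= 1 ->
  s * F t <= t * F s.
Proof.
move=> F_concave F_0 s0; rewrite le_eqVlt => /predU1P[->//|st t1].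
have t0 : 0 < t := lt_trans s0 st.
have := F_concave t 0 (s / t); rewrite F_0 !mulr0 !addr0 divfK ?gt_eqF//.
rewrite lexx ler01 (ltW t0) t1 divr_gt0// ltr_pdivrMr// mul1r st.
move=> /(_ isT isT isT isT)/ltW.
by rewrite mulrAC ler_pdivrMr// [F s * t]mulrC.
Qed.

(** The quotients [F x / x] are nonincreasing on []0, 1[], so their right limit at 0 exists and is
    their supremum. *)
Lemma slope0_cvg {R : realType} (F : R -> R) :
  strictly_concave01 F -> F 0 = 0 ->
  (F x / x)%:E @[x --> 0^'+] --> slope0 F.
Proof.
move=> F_concave F_0.
have h : (F x / x)%:E @[x --> 0^'+] -->
    ereal_sup ((fun x => (F x / x)%:E) @` `]0, 1[%classic).
  apply: (@nonincreasing_at_right_cvge _ _ 0 (BLeft 1)).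
    by rewrite bnd_simp.
  move=> x y; rewrite !in_itv/= => /andP[x0 x1] /andP[y0 y1] xy.
  rewrite lee_fin ler_pdivrMr// mulrAC ler_pdivlMr// mulrC [leRHS]mulrC.
  by apply: concave01_ratio => //; exact: ltW.
rewrite /slope0 (_ : (fun x => ((F x - F 0) / x)%:E) = fun x => (F x / x)%:E).
  by rewrite (cvg_lim _ h).
by apply/funext => x; rewrite F_0 subr0.
Qed.

Section ConcaveCdf.
Variables (d : measure_display) (T : measurableType d) (R : realType).
Variables (P : probability T R) (X : {RV P >-> R}) (F : R -> R).
Hypothesis X01 : forall x, 0 <= X x <= 1.
Hypothesis XF : forall t, cdf X t = (F t)%:E.
Hypothesis F_concave : strictly_concave01 F.
Hypothesis F_0 : F 0 = 0.

Lemma cdf01_mono s t : s <= t -> F s <= F t.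
Proof. by move=> st; rewrite -lee_fin -!XF cdf_nondecreasing. Qed.

Lemma cdf01_sat t : 1 <= t -> F t = 1.
Proof.
move=> t1; apply: EFin_inj; rewrite -XF /cdf /distribution /pushforward.
rewrite (_ : _ @^-1` _ = setT) ?probability_setT//.
apply/seteqP; split=> // x _; rewrite /= in_itv/=.
by apply: le_trans t1; case/andP: (X01 x).
Qed.

Lemma cdf01_le0 t : t <= 0 -> F t = 0.
Proof.
move=> t0; apply/eqP; rewrite eq_le -{1}F_0 cdf01_mono//=.
by rewrite -lee_fin -XF cdf_ge0.
Qed.

Lemma cdf01_le1 t : F t <= 1.
Proof. by rewrite -lee_fin -XF cdf_le1. Qed.

Lemma concave_cdf_ratio s t : 0 < s -> s <= t -> s * F t <= t * F s.
Proof.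
move=> s0 st; have t0 : 0 < t := lt_le_trans s0 st.
have le1 u v := @concave01_ratio R F u v F_concave F_0.
have [t1|/ltW t1] := leP t 1; first exact: le1.
rewrite (cdf01_sat t1) mulr1; have [s1|/ltW s1] := leP s 1.
  have := le1 s 1 s0 s1 (lexx _); rewrite cdf01_sat// mulr1 mul1r => h.
  by apply: (le_trans h); rewrite ler_peMl// (le_trans _ h)// ltW.
by rewrite (cdf01_sat s1) mulr1.
Qed.

(** Left of 0 the function vanishes, at 0 it is right-continuous as a c.d.f., and at [t > 0] the
    ratio bound with [F <= 1] gives a local Lipschitz estimate. *)
Lemma concave_cdf_continuous : continuous F.
Proof.
have bnd s t : 0 < s -> s <= t -> t * (F t - F s) <= t - s.
  move=> s0 st; have := concave_cdf_ratio s0 st.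
  by have := cdf01_le1 t; nra.
move=> t; have [t0|t0|->] := ltgtP t 0.
- apply/cvgrPdist_le => e e0; near=> s.
  rewrite !cdf01_le0 ?subrr ?normr0 ?(ltW e0) ?(ltW t0)// ltW//; near: s.
  exact: lt_nbhsl.
- apply/cvgrPdist_le => e e0; near=> s.
  have s0 : 0 < s by near: s; exact: lt_nbhsr.
  have ts : `|t - s| < e * t.
    by near: s; apply/nbhs_ballP; exists (e * t) => //=; rewrite mulr_gt0.
  have [st|/ltW st] := leP s t.
    have h := bnd s t s0 st; rewrite ger0_norm ?subr_ge0// in ts.
    rewrite ger0_norm ?subr_ge0 ?cdf01_mono// -(ler_pM2l t0).
    by rewrite (le_trans h)// mulrC ltW.
  have h := bnd t s t0 st; rewrite ler0_norm ?subr_le0// opprB in ts.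
  rewrite ler0_norm ?subr_le0 ?cdf01_mono// opprB -(ler_pM2l t0).
  have : t * (F s - F t) <= s * (F s - F t).
    by rewrite ler_wpM2r ?subr_ge0 ?cdf01_mono.
  lra.
- apply/left_right_continuousP; split.
    apply/cvgrPdist_le => e e0; near=> s.
    have s0 : s < 0 by near: s; exact: nbhs_left_lt.
    by rewrite !cdf01_le0 ?subrr ?normr0 ?(ltW e0)// ltW.
  have : cdf X s @[s --> 0^'+] --> cdf X 0 := @cdf_right_continuous _ _ _ _ X 0.
  rewrite XF => /fine_cvgP[_].
  by under eq_cvg do rewrite /= XF.
Unshelve. all: end_near. Qed.
End ConcaveCdf.

(** * Convergence in probability *)

Section NearProb.
Variables (d : measure_display) (T : measurableType d) (R : realType).
Variable P : probability T R.

(* The filter on [nat * T] of the events that hold up to a probability tending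
   to 0: convergence in probability is convergence along it. *)
Definition near_prob : set_system (nat * T) :=
  [set E | exists A : nat -> set T, [/\ forall m, measurable (A m),
     P (A m) @[m --> \oo] --> 0%E & forall m x, ~ A m x -> E (m, x)]].

Global Instance near_prob_filter : Filter near_prob.
Proof.
split.
- exists (fun=> set0); split => //; rewrite measure0; exact: cvg_cst.
- move=> E1 E2 [A1 [m1 c1 h1]] [A2 [m2 c2 h2]].
  exists (fun m => A1 m `|` A2 m); split.
  + by move=> m; exact: measurableU.
  + apply: (@squeeze_cvge _ _ _ _ (fun=> 0%E) _ (fun m => P (A1 m) + P (A2 m))%E).
    * by apply: nearW => m; rewrite measure_ge0/= measureU2.
    * exact: cvg_cst.
    * by rewrite -[X in _ --> X](adde0 0%E); apply: cvgeD.
  + by move=> m x /not_orP[x1 x2]; split; [exact: h1|exact: h2].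
- move=> E1 E2 E12 [A [mA cA hA]]; exists A; split => // m x Ax.
  by apply: E12; exact: hA.
Qed.

(** The exceptional event is the whole space for the finitely many early indices and empty
    afterwards. *)
Lemma near_prob_fst (Q : nat -> Prop) :
  (\forall m \near \oo, Q m) -> \forall z \near near_prob, Q z.1.
Proof.
move=> [N _ NQ]; exists (fun m => if (N <= m)%N then set0 else setT); split.
- by move=> m; case: ifP.
- apply: (@cvg_trans _ (0%E @[m --> \oo])); last exact: cvg_cst.
  by apply: near_eq_cvg; exists N => // m /= ->; rewrite measure0.
- by move=> m x /=; case: ifP => [+ _|_ /(_ I)//]; exact: NQ.
Qed.

Lemma cvg_near_prob_fst (u : nat -> R) (l : R) :
  u m @[m --> \oo] --> l -> u z.1 @[z --> near_prob] --> l.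
Proof. by move=> ul A /ul; exact: near_prob_fst. Qed.

Lemma cvg_near_prob (X : nat -> T -> R) (c : R) :
  (forall m, measurable_fun setT (X m)) -> cvg_in_prob P X c ->
  X z.1 z.2 @[z --> near_prob] --> c.
Proof.
move=> mX Xc; apply/cvgrPdist_lt => e e0.
exists (fun m => [set x | e <= `|X m x - c|]); split => [m||m x /=].
- rewrite -[X in measurable X]setTI.
  have mf : measurable_fun setT (fun x => `|X m x - c|).
    by apply: measurableT_comp => //; exact: measurable_funB.
  rewrite (_ : [set x | _] = (fun x => `|X m x - c|) @^-1` `[e, +oo[).
    exact: mf.
  by apply/seteqP; split=> x /=; rewrite in_itv/= andbT.
- exact: Xc.
- by move=> /negP; rewrite -ltNge distrC.
Qed.

(** Off the exceptional event [A m] the variable is within [e / 2] of [l]; on it the error is at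
    most 1 and contributes at most [P (A m)]. *)
Lemma expectation_cvg (X : nat -> T -> R) (l : R) :
  (forall m, measurable_fun setT (X m)) -> (forall m x, 0 <= X m x <= 1) ->
  0 <= l <= 1 -> X z.1 z.2 @[z --> near_prob] --> l ->
  ('E_P[X m])%E @[m --> \oo] --> l%:E.
Proof.
move=> mX X01 /andP[l0 l1] Xl.
have mXE m : measurable_fun setT (fun x => (X m x)%:E).
  exact/measurable_EFinP.
have cst (r : R) : (\int[P]_x r%:E = r%:E)%E.
  by rewrite integral_cst//= probability_setT mule1.
have E0 m : (0 <= 'E_P[X m])%E.
  by rewrite unlock; apply: integral_ge0 => x _; rewrite lee_fin; case/andP: (X01 m x).
have E1 m : ('E_P[X m] <= 1)%E.
  rewrite unlock -[leRHS](cst 1); apply: ge0_le_integral => //.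
  - by move=> x _; rewrite lee_fin; case/andP: (X01 m x).
  - by move=> x _; rewrite lee_fin; case/andP: (X01 m x).
have Efin m : ('E_P[X m])%E \is a fin_num.
  by rewrite ge0_fin_numE// (le_lt_trans (E1 m))// ltry.
apply/fine_cvgP; split; first exact: nearW.
apply/cvgrPdist_le => e e0; have e2 : 0 < e / 2 by lra.
have /cvgrPdist_le/(_ _ e2)[A [mA cA hA]] := Xl.
have /fine_cvgP[_ /cvgrPdist_le/(_ _ e2)] := cA.
apply: filterS => m /=; rewrite sub0r normrN => PA.
have PAfin : P (A m) \is a fin_num by exact: fin_num_measure.
have {}PA : (P (A m) <= (e / 2)%:E)%E.
  by rewrite -(fineK PAfin) lee_fin (le_trans (ler_norm _)).
have m1A : measurable_fun setT (fun x => (\1_(A m) x : R)%:E).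
  by apply/measurable_EFinP; exact: measurable_indic.
have i1A : (\int[P]_x (\1_(A m) x : R)%:E = P (A m))%E.
  by rewrite integral_indic// setIT.
have i10 x : 0 <= (\1_(A m) x : R) by rewrite indicE.
have upper : ('E_P[X m] <= (l + e / 2)%:E + P (A m))%E.
  rewrite unlock -i1A -(cst (l + e / 2)) -ge0_integralD//=; last first.
    by move=> x _; rewrite lee_fin; lra.
  apply: ge0_le_integral => //.
  - by move=> x _; rewrite lee_fin; case/andP: (X01 m x).
  - by apply: emeasurable_funD => //; exact: measurable_cst.
  - move=> x _; rewrite -EFinD lee_fin indicE; have /andP[x0 x1] := X01 m x.
    case: (boolP (x \in A m)) => [_|/negP xA]; rewrite ?mulr0n ?mulr1n; first by lra.
    have /hA/= : ~ A m x by move=> h; apply: xA; rewrite inE.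
    by rewrite ler_distlC => /andP[]; lra.
(* Written with sums only, so that every integrand is nonnegative. *)
have lower : (l%:E <= 'E_P[X m] + ((e / 2)%:E + P (A m)))%E.
  rewrite unlock -i1A -(cst (e / 2)) -{1}(cst l) -!ge0_integralD//=; last first.
  - by move=> x _; rewrite lee_fin ltW.
  - by apply: emeasurable_funD => //; exact: measurable_cst.
  - by move=> x _; rewrite -EFinD lee_fin addr_ge0// ltW.
  - by move=> x _; rewrite lee_fin; case/andP: (X01 m x).
  apply: ge0_le_integral => //.
  - by apply: emeasurable_funD => //; apply: emeasurable_funD => //;
      exact: measurable_cst.
  - move=> x _; rewrite -!EFinD lee_fin indicE; have /andP[x0 x1] := X01 m x.
    case: (boolP (x \in A m)) => [_|/negP xA]; rewrite ?mulr0n ?mulr1n; first by lra.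
    have /hA/= : ~ A m x by move=> h; apply: xA; rewrite inE.
    by rewrite ler_distlC => /andP[]; lra.
rewrite -(fineK (Efin m)) in upper lower; rewrite -(fineK PAfin) in upper lower PA.
move: upper lower PA; rewrite -!EFinD !lee_fin => u v w.
by rewrite ler_distl; apply/andP; split; lra.
Qed.

(** A preimage is a finite union of events [S x = A], each a finite intersection of membership
    events and their complements. *)
Lemma measurable_fun_random_set (I : finType) (S : T -> {set I}) (f : {set I} -> R) :
  random_set S -> measurable_fun setT (fun x => f (S x)).
Proof.
move=> mS _ B _; rewrite setTI.
have -> : (fun x => f (S x)) @^-1` B =
    \bigcup_(A in [set A : {set I} | B (f A)])
      \bigcap_(j in [set: I]) (if j \in A then [set x | j \in S x]
                               else ~` [set x | j \in S x]).
  apply/seteqP; split => [x Bx|x [A BA xA]] /=.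
    by exists (S x) => // j _; case: ifP => //= /negbT /negP.
  rewrite (_ : S x = A)//; apply/setP => j; have := xA j Logic.I.
  by case: ifP => //= _ /negP/negbTE.
apply: fin_bigcup_measurable => // A _; apply: fin_bigcap_measurable => // j _.
by case: ifP => _; [exact: mS|apply: measurableC; exact: mS].
Qed.
End NearProb.

(** * The critical level and the theorem *)

(** By contradiction: if no feasible point beats any [u], the points [alpha * u * w] with small [u]
    bound the slope sum [S] by [alpha^-1], whereas [w] was picked with [S^-1 < alpha]. *)
Lemma alpha_star_lt {R : realType} (G : nat) (pi pi0 pibar0 : 'I_G -> R)
    (F : 'I_G -> R -> R) (alpha : R) :
  (forall g, 0 < pi g) -> (forall g, 0 < pi0 g) -> (forall g, 0 < 1 - pi0 g) ->
  (forall g, strictly_concave01 (F g)) -> (forall g, F g 0 = 0) ->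
  (forall g t, 0 <= F g t) ->
  (alpha_star pi pi0 pibar0 F < alpha%:E)%E ->
  0 < alpha /\ exists u x, [/\ 0 < u, u <= 1,
    feas (fun g => pi g * pibar0 g) (alpha * u) x
    & u < \sum_g pi g * (pi0 g * Ucdf (x g) + (1 - pi0 g) * F g (x g))].
Proof.
move=> pi_gt0 pi0_gt0 pi1_gt0 F_concave F_0 F_ge0.
move=> /ereal_inf_lt[_ [w [w0 wb] <-]].
set S := (\sum_(g < G) _)%E => Slt.
have slope_ge0 g : (0 <= slope0 (F g))%E.
  apply: (cvge_to_ge (slope0_cvg (F_concave g) (F_0 g))).
  by near=> x; rewrite lee_fin divr_ge0.
have S0 : (0 <= S)%E.
  apply: sume_ge0 => g _; apply: mule_ge0.
    by rewrite lee_fin mulr_ge0// ltW.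
  apply: adde_ge0; first by rewrite lee_fin ltW.
  by apply: mule_ge0 => //; rewrite lee_fin ltW.
have alpha_gt0 : 0 < alpha.
  by rewrite -lte_fin (le_lt_trans _ Slt)// inve_ge0.
split=> //; apply: contrapT => no_u.
have hS : (S <= (alpha^-1)%:E)%E.
  (* Slopes at 0 are limits of chord slopes, so bounding the chord version for small [x] suffices,
     even when [S] might be infinite. *)
  have cS : (\sum_(g < G) (pi g * w g)%:E *
      ((pi0 g)%:E + (1 - pi0 g)%:E * (F g x / x)%:E))%E @[x --> 0^'+] --> S.
    apply: cvg_nnesum => g _.
      near=> x; apply: mule_ge0; first by rewrite lee_fin mulr_ge0// ltW.
      apply: adde_ge0; first by rewrite lee_fin ltW.
      by apply: mule_ge0; rewrite lee_fin ?divr_ge0// ltW.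
    apply: cvgeZl => //; apply: cvgeD; [exact: fin_num_adde_defr|exact: cvg_cst|].
    by apply: cvgeZl => //; exact: slope0_cvg.
  apply: (cvge_to_le cS); near=> x.
  have x0 : 0 < x by near: x; exact: nbhs_right_gt.
  have x1 : x < 1 by near: x; exact: nbhs_right_lt.
  rewrite (eq_bigr (fun g =>
    (pi g * w g * (pi0 g + (1 - pi0 g) * (F g x / x)))%:E)) => [|g _]; last first.
    by rewrite -[((1 - _)%:E * _)%E]EFinM -EFinD -EFinM.
  rewrite sumEFin lee_fin.
  (* [K] is positive and dominates every weight, so the [u] below puts all thresholds under [x],
     where chord slopes are at least the one at [x]. *)
  pose K := 1 + \sum_g w g.
  have K1 : 1 <= K by rewrite lerDl sumr_ge0.
  have K0 : 0 < K := lt_le_trans ltr01 K1.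
  pose u := Num.min 1 (x / (alpha * K)).
  have u0 : 0 < u by rewrite lt_min ltr01 divr_gt0 ?mulr_gt0.
  have u1 : u <= 1 by rewrite ge_min lexx.
  have au0 : 0 < alpha * u by rewrite mulr_gt0.
  pose y g := alpha * u * w g.
  have yx g : 0 <= y g <= x.
    rewrite /y mulr_ge0 ?(ltW au0)//=.
    have wK : w g <= K.
      rewrite /K (bigD1 g)//= addrCA lerDl addr_ge0 ?ler01//.
      by apply: sumr_ge0.
    have : alpha * u * K <= x.
      have : u <= x / (alpha * K) by rewrite ge_min lexx orbT.
      by rewrite ler_pdivlMr ?mulr_gt0// mulrA [u * _]mulrC.
    by apply: le_trans; rewrite ler_pM2l.
  have fy : feas (fun g => pi g * pibar0 g) (alpha * u) y.
    split=> [g|]; first by have /andP[-> /le_trans->] := yx g; rewrite ?ltW.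
    rewrite /cost (eq_bigr (fun g => alpha * u * (pi g * pibar0 g * w g))).
      by rewrite -mulr_sumr ler_piMr// ltW.
    by move=> g _; rewrite /y mulrCA.
  have : \sum_g pi g * (pi0 g * Ucdf (y g) + (1 - pi0 g) * F g (y g)) <= u.
    by rewrite leNgt; apply/negP => h; apply: no_u; exists u, y.
  move=> hu; rewrite -[leRHS]mul1r ler_pdivlMr// -(ler_pM2r u0) mul1r.
  apply: le_trans hu; rewrite -mulrA mulr_suml; apply: ler_sum => g _.
  have /andP[y0 yx'] := yx g.
  rewrite Ucdf_id; last by rewrite y0 (le_trans yx') ?ltW.
  rewrite -[leLHS]mulrA -mulrA ler_pM2l//.
  have -> : w g * ((pi0 g + (1 - pi0 g) * (F g x / x)) * (alpha * u)) =
      pi0 g * y g + (1 - pi0 g) * (y g * F g x / x) by rewrite /y; ring.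
  rewrite lerD2l ler_pM2l// ler_pdivrMr// [leRHS]mulrC.
  move: y0; rewrite le_eqVlt => /predU1P[<-|y0].
    by rewrite mul0r F_0 mulr0.
  exact: concave01_ratio (F_concave g) (F_0 g) y0 yx' (ltW x1).
have Sfin : S \is a fin_num by rewrite ge0_fin_numE// (le_lt_trans hS)// ltry.
(* If [S] is 0 its inverse is [+oo], which cannot lie below [alpha]. *)
move: Slt hS; rewrite -(fineK Sfin) inver lee_fin; case: eqP => [_|/eqP s0].
  by rewrite ltNge leey.
rewrite lte_fin => h1 h2.
have sgt0 : 0 < fine S by rewrite lt_neqAle eq_sym s0 fine_ge0.
by move: h1; rewrite ltNge -[leLHS]invrK lef_pV2 ?posrE ?invr_gt0// h2.
Unshelve. all: end_near. Qed.

(** * Counting rejections, and measurability of the empirical c.d.f.s *)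

Section Counting.
Variable R : realType.

Lemma card_hyps (G : nat) (n : 'I_G -> nat) (Q : forall g, 'I_(n g) -> bool) :
  #|[set j : hyps n | Q (tag j) (tagged j)]%SET|%:R =
  \sum_g \sum_(i < n g) (Q g i)%:R :> R.
Proof.
rewrite -sum1_card natr_sum (sig_big_dep (fun=> true) (fun=> predT)
  (fun g i => (Q g i)%:R)) /= big_mkcond /=.
by apply: eq_bigr => j _; rewrite inE; case: (Q _ _).
Qed.

Variables (k : nat) (H : 'I_k -> bool).

Lemma nb_alt_le : (nb_alt H <= k)%N.
Proof.
rewrite -[leqRHS]card_ord -sum1_card; apply: leq_sum => i _.
by case: (H i).
Qed.

Lemma sum_null : \sum_(i < k) (~~ H i)%:R = (nb_null H)%:R :> R.
Proof.
rewrite -natr_sum; congr _%:R; apply/eqP.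
rewrite -(eqn_add2r (nb_alt H)) /nb_null subnK ?nb_alt_le//.
rewrite /nb_alt -big_split/= (eq_bigr (fun=> 1%N)); last by move=> i _; case: (H i).
by rewrite sum_nat_const card_ord muln1.
Qed.

(** Without true nulls the inverse in [ecdf_null] is 0, but then every summand on the left is 0
    too. *)
Lemma ecdf_nullE (q : 'I_k -> R) (t : R) :
  \sum_(i < k) ((q i <= t) && ~~ H i)%:R = (nb_null H)%:R * ecdf_null H q t.
Proof.
have [N0|N0] := eqVneq (nb_null H)%:R (0 : R); last by rewrite /ecdf_null mulVKf.
rewrite N0 mul0r; apply: big1 => i _.
have : \sum_(i < k) (~~ H i)%:R = 0 :> R by rewrite sum_null.
move=> /psumr_eq0P => /(_ (fun _ _ => ler0n _ _) i isT).
by case: (H i); rewrite ?andbF//= => /eqP; rewrite oner_eq0.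
Qed.

Lemma ecdf_altE (q : 'I_k -> R) (t : R) :
  \sum_(i < k) ((q i <= t) && H i)%:R = (nb_alt H)%:R * ecdf_alt H q t.
Proof.
have [N0|N0] := eqVneq (nb_alt H)%:R (0 : R); last by rewrite /ecdf_alt mulVKf.
rewrite N0 mul0r; apply: big1 => i _.
have : \sum_(i < k) (H i)%:R = 0 :> R by rewrite -natr_sum.
move=> /psumr_eq0P => /(_ (fun _ _ => ler0n _ _) i isT).
by case: (H i); rewrite ?andbF//= => /eqP; rewrite oner_eq0.
Qed.
End Counting.

Section EcdfMeasurable.
Variables (d : measure_display) (T : measurableType d) (R : realType).
Variables (P : probability T R) (k : nat) (H : 'I_k -> bool).
Variable X : 'I_k -> {RV P >-> R}.

Lemma measurable_count (b : 'I_k -> bool) (t : R) :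
  measurable_fun setT (fun x => \sum_(i < k) ((X i x <= t) && b i)%:R : R).
Proof.
apply: measurable_sum => i; case: (b i); last first.
  by under eq_fun do rewrite andbF; exact: measurable_cst.
rewrite (_ : (fun x => _) = \1_((X i) @^-1` `]-oo, t])).
  apply: measurable_indic; rewrite -[X in measurable X]setTI.
  exact: measurable_funP.
apply/funext => x; rewrite indicE andbT; congr ((nat_of_bool _)%:R).
by apply/idP/idP; rewrite inE /= in_itv.
Qed.

Lemma measurable_ecdf_null (t : R) :
  measurable_fun setT (fun x => ecdf_null H (fun i => X i x) t).
Proof. by apply: measurable_funM => //; exact: measurable_count. Qed.

Lemma measurable_ecdf_alt (t : R) :
  measurable_fun setT (fun x => ecdf_alt H (fun i => X i x) t).
Proof. by apply: measurable_funM => //; exact: measurable_count. Qed.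
End EcdfMeasurable.

(** * Asymptotic FDR of ADDOW *)

Theorem theorem5p1
  (R : realType) (d : measure_display) (T : measurableType d)
  (P : probability T R) (G : nat) (hG : (2 <= G)%N)
  (* group sizes *)
  (n : nat -> 'I_G -> nat)
  (n_mono : forall (g : 'I_G) (a b : nat), (a <= b)%N -> (n a g <= n b g)%N)
  (n_sum : forall m : nat, (\sum_(g < G) n m g)%N = m)
  (* hypotheses and p-values *)
  (H : forall (m : nat) (g : 'I_G), 'I_(n m g) -> bool)
  (p : forall (m : nat) (g : 'I_G), 'I_(n m g) -> {RV P >-> R})
  (p01 : forall (m : nat) (g : 'I_G) (i : 'I_(n m g)) (x : T),
    0 <= p m g i x <= 1)
  (* true nulls: uniform p-values *)
  (p_null : forall (m : nat) (g : 'I_G) (i : 'I_(n m g)), H m g i = false ->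
    forall A : set R, measurable A ->
      distribution P (p m g i) A = uniform_prob (@ltr01 R) A)
  (* alternatives: common strictly concave c.d.f. in each group *)
  (F : 'I_G -> R -> R)
  (p_alt : forall (m : nat) (g : 'I_G) (i : 'I_(n m g)), H m g i = true ->
    forall t : R, cdf (p m g i) t = (F g t)%:E)
  (F_concave : forall g : 'I_G, strictly_concave01 (F g))
  (F_0 : forall g : 'I_G, F g 0 = 0)
  (* asymptotic proportions *)
  (pi pi0 : 'I_G -> R)
  (pi_gt0 : forall g : 'I_G, 0 < pi g)
  (pi0_gt0 : forall g : 'I_G, 0 < pi0 g)
  (pi1_gt0 : forall g : 'I_G, 0 < 1 - pi0 g)
  (pi_lim : forall g : 'I_G,
    ((n m g)%:R / m%:R : R) @[m --> \oo] --> pi g)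
  (pi0_lim : forall g : 'I_G,
    ((nb_null (H m g))%:R / (n m g)%:R : R) @[m --> \oo] --> pi0 g)
  (* weak dependence *)
  (wd_null : forall (g : 'I_G) (t : R), 0 <= t ->
    cvg_in_prob P (fun m x => ecdf_null (H m g) (fun i => p m g i x) t) (Ucdf t))
  (wd_alt : forall (g : 'I_G) (t : R), 0 <= t ->
    cvg_in_prob P (fun m x => ecdf_alt (H m g) (fun i => p m g i x) t) (F g t))
  (* estimators of the proportions of true nulls *)
  (pihat0 : nat -> 'I_G -> {RV P >-> R})
  (pihat0_01 : forall (m : nat) (g : 'I_G) (x : T), 0 < pihat0 m g x <= 1)
  (pibar0 : 'I_G -> R)
  (pibar0_ge : forall g : 'I_G, pi0 g <= pibar0 g)
  (pihat0_lim : forall g : 'I_G,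
    cvg_in_prob P (fun m x => pihat0 m g x) (pibar0 g))
  (* target level *)
  (alpha : R)
  (alpha_gt : (alpha_star pi pi0 pibar0 F < alpha%:E)%E)
  (alpha_lt1 : alpha < 1)
  (* optimal random weight functions, and ADDOW *)
  (W : nat -> T -> R -> 'I_G -> R)
  (W_opt : forall (m : nat) (x : T),
    optimal_weights m (fun g i => p m g i x) (fun g => pihat0 m g x) alpha (W m x))
  (W_random : forall m : nat, random_weights (W m))
  (ADDOW_random : forall m : nat,
    random_set (fun x => MWBH m (fun g i => p m g i x) alpha (W m x))) :
  let ADDOW (m : nat) (x : T) := MWBH m (fun g i => p m g i x) alpha (W m x) in
  exists l : R,
    [/\ FDR P (true_nulls (H m)) (ADDOW m) @[m --> \oo] --> l%:E,
        l <= alpha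
      & alpha <= \sum_(g < G) pi g * pibar0 g ->
        forall C : R, 1 <= C ->
          (forall g : 'I_G, pibar0 g = C * pi0 g) -> l = alpha / C].
Proof.
move=> ADDOW.
have pi_sum : \sum_g pi g = 1.
  have h : \sum_g ((n m g)%:R / m%:R : R) @[m --> \oo] --> \sum_g pi g.
    exact: cvg_finsum.
  have h1 : (fun m => \sum_g ((n m g)%:R / m%:R : R)) @ \oo --> (1 : R).
    apply: cvg_near_cst; exists 1%N => // m /= m0.
    by rewrite -mulr_suml -natr_sum n_sum divff// pnatr_eq0 -lt0n.
  exact: (cvg_unique _ h h1).
have null_lim g : ((nb_null (H m g))%:R / m%:R : R) @[m --> \oo] --> pi g * pi0 g.
  rewrite mulrC.
  apply: cvg_eq_near (cvgM (pi0_lim g) (pi_lim g)); near=> m.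
  rewrite /= mulrA; congr (_ / _).
  have [n0|n0] := eqVneq (n m g) 0%N; last by rewrite divfK// pnatr_eq0.
  have : (nb_null (H m g) <= n m g)%N by exact: leq_subr.
  by rewrite [X in (_ <= X)%N]n0 leqn0 => /eqP->; rewrite !mul0r.
have alt_lim g :
    ((nb_alt (H m g))%:R / m%:R : R) @[m --> \oo] --> pi g * (1 - pi0 g).
  rewrite mulrBr mulr1.
  apply: cvg_eq_near (cvgB (pi_lim g) (null_lim g)); near=> m.
  rewrite /= -mulrBl; congr (_ / _).
  by rewrite /nb_null natrB ?nb_alt_le// opprB addrC subrK.
(* An actual alternative p-value, present because the limiting proportion is positive, supplies the
   c.d.f. properties of [F g]. *)
have alt_ex g : exists m, exists i, H m g i = true.
  have apos : 0 < pi g * (1 - pi0 g) by rewrite mulr_gt0.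
  have [m] := @filter_ex _ \oo _ _ (cvgr_gt _ (alt_lim g) _ apos).
  move=> hm; exists m; apply: contrapT => noH; move: hm.
  rewrite /nb_alt big1 ?mul0r ?ltxx// => i _.
  by case E : (H m g i) => //; exfalso; apply: noH; exists i.
have F_facts g : [/\ forall s t, s <= t -> F g s <= F g t,
    forall t, 1 <= t -> F g t = 1, forall t, t <= 0 -> F g t = 0
    & continuous (F g)].
  have [m [i Hi]] := alt_ex g; have X01 := p01 m g i; have XF := p_alt m g i Hi.
  split.
  - exact: cdf01_mono XF.
  - exact: cdf01_sat X01 XF.
  - exact: cdf01_le0 XF (F_0 g).
  - exact: concave_cdf_continuous X01 XF (F_concave g) (F_0 g).
have F_mono g : forall s t, s <= t -> F g s <= F g t by have [] := F_facts g.
have F_sat g : forall t, 1 <= t -> F g t = 1 by have [] := F_facts g.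
have F_le0 g : forall t, t <= 0 -> F g t = 0 by have [] := F_facts g.
have F_cont g : continuous (F g) by have [] := F_facts g.
have F_ge0 g t : 0 <= F g t.
  have [t0|/ltW t0] := leP t 0; first by rewrite F_le0.
  by rewrite -(F_0 g) F_mono.
pose D g t := pi g * (pi0 g * Ucdf t + (1 - pi0 g) * F g t).
pose c g := pi g * pibar0 g.
have D0 g : D g 0 = 0 by rewrite /D Ucdf_le0// F_0 !mulr0 addr0 mulr0.
have D_mono g s t : s <= t -> D g s <= D g t.
  move=> st; rewrite /D ler_pM2l// lerD// ler_pM2l//; [exact: Ucdf_mono|exact: F_mono].
have D_cont g : continuous (D g).
  move=> t; apply: cvgM; first exact: cvg_cst.
  apply: cvgD; (apply: cvgM; first exact: cvg_cst).
    exact: Ucdf_continuous.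
  exact: F_cont.
have D_concave g : strictly_concave01 (D g).
  move=> s t l s01 t01 st l01; have := F_concave g s t l s01 t01 st l01.
  have /andP[l0 l1] := l01.
  have s0 : 0 <= l * s + (1 - l) * t <= 1.
    by have /andP[? ?] := s01; have /andP[? ?] := t01; apply/andP; split; nra.
  rewrite -(ltr_pM2l (pi1_gt0 g)) => Fl.
  rewrite /D !Ucdf_id// [ltLHS](_ : _ = pi g * (l * (pi0 g * s +
     (1 - pi0 g) * F g s) + (1 - l) * (pi0 g * t + (1 - pi0 g) * F g t))).
    by rewrite ltr_pM2l//; lra.
  ring.
have D_sat g t : 1 <= t -> D g t = D g 1.
  by move=> t1; rewrite /D !Ucdf_sat// !F_sat.
have D_total : \sum_g D g 1 = 1.
  rewrite -[RHS]pi_sum; apply: eq_bigr => g _.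
  by rewrite /D Ucdf_sat// F_sat// !mulr1 subrKC mulr1.
have c_gt0 g : 0 < c g by rewrite mulr_gt0// (lt_le_trans _ (pibar0_ge g)).
have [alpha_gt0 [u0 [x0 [u00 u01 fx0 ux0]]]] :=
  alpha_star_lt pi_gt0 pi0_gt0 pi1_gt0 F_concave F_0 F_ge0 alpha_gt.
have supercrit : exists u, [/\ 0 < u, u <= 1 & u < maxobj c D_cont (alpha * u)].
  exists u0; split=> //; apply: lt_le_trans ux0 _.
  by apply: maxobj_max fx0; rewrite mulr_ge0// ltW.
(* [B] and [A] are normalized by [m], not by group sizes: summed over groups they give the fractions
   of rejections and of false rejections. *)
pose B g (z : nat * T) t : R :=
  z.1%:R^-1 * \sum_(i < n z.1 g) (p z.1 g i z.2 <= t)%R%:R.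
pose A g (z : nat * T) t : R :=
  z.1%:R^-1 * \sum_(i < n z.1 g) ((p z.1 g i z.2 <= t)%R && ~~ H z.1 g i)%:R.
pose chat g (z : nat * T) : R := (n z.1 g)%:R / z.1%:R * pihat0 z.1 g z.2.
pose Wz (z : nat * T) := W z.1 z.2.
have p_lt0 z g i t : t < 0 -> (p z.1 g i z.2 <= t)%R = false.
  move=> t0; apply/negbTE; rewrite -ltNge (lt_le_trans t0)//.
  by case/andP: (p01 z.1 g i z.2).
have p_ge1 z g i t : 1 <= t -> (p z.1 g i z.2 <= t)%R = true.
  by move=> t1; apply: le_trans t1; case/andP: (p01 z.1 g i z.2).
have A_cvg g t : A g z t @[z --> near_prob P] --> pi g * pi0 g * Ucdf t.
  (* Weak dependence covers [t >= 0] only, while [monotone_cvg_uniform] needs all [t]; for [t < 0]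
     the counts vanish. *)
  have [t0|t0] := ltP t 0.
    rewrite Ucdf_le0 ?(ltW t0)// mulr0 (_ : A g ^~ t = fun=> 0); first exact: cvg_cst.
    apply/funext => z; rewrite /A big1 ?mulr0// => i _; by rewrite p_lt0.
  have h := cvg_near_prob (fun m => measurable_ecdf_null (H m g) (p m g) t)
    (wd_null g t t0).
  apply: cvg_eq_near (cvgM (cvg_near_prob_fst P (null_lim g)) h); near=> z => /=.
  by rewrite /A ecdf_nullE [RHS]mulrA [z.1%:R^-1 * _]mulrC.
have B_cvg g t : B g z t @[z --> near_prob P] --> D g t.
  have [t0|t0] := ltP t 0.
    rewrite /D Ucdf_le0 ?F_le0 ?(ltW t0)// !mulr0 addr0 mulr0.
    rewrite (_ : B g ^~ t = fun=> 0); first exact: cvg_cst.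
    by apply/funext => z; rewrite /B big1 ?mulr0// => i _; rewrite p_lt0.
  have h := cvg_near_prob (fun m => measurable_ecdf_alt (H m g) (p m g) t)
    (wd_alt g t t0).
  have -> : D g t = pi g * pi0 g * Ucdf t + pi g * (1 - pi0 g) * F g t.
    by rewrite /D; ring.
  apply: cvg_eq_near (cvgD (A_cvg g t) (cvgM (cvg_near_prob_fst P (alt_lim g)) h)).
  near=> z => /=.
  rewrite /A /B [_ / z.1%:R]mulrC -[_ * _ * ecdf_alt _ _ _]mulrA -ecdf_altE -mulrDr.
  congr (_ * _); rewrite -big_split/=; apply: eq_bigr => i _.
  by case: (_ <= t); case: (H _ _ _); rewrite ?addr0 ?add0r.
have sum_mono z g (b : 'I_(n z.1 g) -> bool) s t : s <= t ->
    z.1%:R^-1 * \sum_(i < n z.1 g) ((p z.1 g i z.2 <= s)%R && b i)%:R <=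
    z.1%:R^-1 * \sum_(i < n z.1 g) ((p z.1 g i z.2 <= t)%R && b i)%:R :> R.
  move=> st; apply: ler_wpM2l; first by rewrite invr_ge0.
  apply: ler_sum => i _; rewrite ler_nat.
  have : (p z.1 g i z.2 <= s)%R ==> (p z.1 g i z.2 <= t)%R.
    by apply/implyP => /le_trans; apply.
  by case: (_ <= s); case: (_ <= t); case: (b i).
have B_unif e : 0 < e ->
    \forall z \near near_prob P, forall g t, 0 <= t -> `|B g z t - D g t| <= e.
  move=> e0; apply: filter_forall => g.
  apply: (@monotone_cvg_uniform _ _ (near_prob P) _ (D g) (B g)) => //.
  - move=> z s t st; have := @sum_mono z g (fun=> true) s t st.
    rewrite /B; under eq_bigr do rewrite andbT.
    by under [in leRHS]eq_bigr do rewrite andbT.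
  - by move=> t t1; rewrite D_sat.
  - by move=> z t t1; congr (_ * _); apply: eq_bigr => i _; rewrite !p_ge1.
have A_unif e : 0 < e -> \forall z \near near_prob P, forall g t, 0 <= t ->
    `|A g z t - pi g * pi0 g * Num.min t 1| <= e.
  move=> e0; apply: filter_forall => g.
  have : \forall z \near near_prob P, forall t, 0 <= t ->
      `|A g z t - pi g * pi0 g * Ucdf t| <= e.
    apply: (@monotone_cvg_uniform _ _ (near_prob P) _
      (fun t => pi g * pi0 g * Ucdf t) (A g)) => //.
    - by move=> t; apply: cvgM; [exact: cvg_cst|exact: Ucdf_continuous].
    - by move=> z s t; exact: sum_mono.
    - by move=> t t1; rewrite !Ucdf_sat.
    - by move=> z t t1; congr (_ * _); apply: eq_bigr => i _; rewrite !p_ge1.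
  by apply: filterS => z hz t t0; rewrite -Ucdf_min//; exact: hz.
have chat_cvg g : chat g z @[z --> near_prob P] --> c g.
  apply: cvgM; first exact: (cvg_near_prob_fst P (pi_lim g)).
  apply: (cvg_near_prob (X := fun m x => pihat0 m g x) _ (pihat0_lim g)) => m.
  exact: measurable_funPT.
have GempE z w u : Gemp alpha B z w u =
    Ghat z.1 (fun g i => p z.1 g i z.2) alpha (fun=> w) u.
  by rewrite /Gemp /Ghat mulr_sumr.
have Wz_opt z u : 0 <= u <= 1 ->
    [/\ forall g, 0 <= Wz z u g, \sum_g chat g z * Wz z u g <= 1
      & forall w, (forall g, 0 <= w g) -> \sum_g chat g z * w g <= 1 ->
          Gemp alpha B z w u <= Gemp alpha B z (Wz z u) u].
  move=> u01'; have [[W0 W1] Wmax] := W_opt z.1 z.2 u u01'; split => // w w0 w1.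
  by rewrite !GempE; apply: Wmax.
pose us := ulim c D_cont alpha.
pose xs := opt c D_cont (alpha * us).
have us0 : 0 < us := ulim_gt0 supercrit.
have aus0 : 0 <= alpha * us by rewrite mulr_ge0// ltW.
have [xs01 xsb] : feas c (alpha * us) xs := opt_feas c D_cont aus0.
exists ((\sum_g pi g * pi0 g * xs g) / us).
have l_ge0 : 0 <= (\sum_g pi g * pi0 g * xs g) / us.
  rewrite divr_ge0 ?(ltW us0)//; apply: sumr_ge0 => g _.
  by have /andP[xs0 _] := xs01 g; rewrite !mulr_ge0// ltW.
(* Since [pi0 g <= pibar0 g], the numerator is at most the cost of [xs], hence at most
   [alpha * us]. *)
have l_le : (\sum_g pi g * pi0 g * xs g) / us <= alpha.
  rewrite ler_pdivrMr//; apply: le_trans xsb; apply: ler_sum => g _.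
  by rewrite ler_wpM2r// ?ler_pM2l//; case/andP: (xs01 g).
split => //; last first.
  move=> alpha_le C C1 pibarC.
  have us1 : us <= 1 := ulim_le1 supercrit.
  (* The budget is spent entirely because [us <= 1] and [alpha] is at most the total cost; the cost
     of [xs] is [C] times the numerator of [l]. *)
  have : alpha * us = C * \sum_g pi g * pi0 g * xs g.
    rewrite -(opt_exhausts D_mono D_cont D_concave c_gt0 aus0).
      rewrite /cost mulr_sumr; apply: eq_bigr => g _.
      by rewrite /c pibarC -/xs; ring.
    by apply: le_trans alpha_le; rewrite ler_piMr// ltW.
  move=> h; have C0 : C != 0 by rewrite gt_eqF// (lt_le_trans ltr01).
  by apply: (mulfI C0); rewrite mulrA -h mulfK ?gt_eqF// [RHS]mulrC divfK.
apply: (expectation_cvg (P := P)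
  (X := fun m x => #|ADDOW m x :&: true_nulls (H m)|%:R / (maxn #|ADDOW m x| 1)%:R)).
- move=> m; exact: (measurable_fun_random_set (fun S : {set hyps (n m)} =>
    #|S :&: true_nulls (H m)|%:R / (maxn #|S| 1)%:R) (ADDOW_random m)).
- move=> m x; rewrite divr_ge0//= ler_pdivrMr ?ltr0n ?leq_max ?orbT// mul1r ler_nat.
  by rewrite leq_max subset_leq_card// subsetIl.
- by rewrite l_ge0 (le_trans l_le)// ltW.
have := @ratio_cvg _ _ _ _ D0 D_mono D_cont D_concave D_sat D_total c_gt0 _
  alpha_gt0 supercrit _ _ (near_prob_filter P) _ _ _ B_unif chat_cvg Wz_opt
  A (fun g => pi g * pi0 g) A_unif.
move=> hR; apply: cvg_eq_near hR.
(* The fraction of rejections tends to [us > 0], so it is eventually positive: then [m] is nonzero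
   and some hypothesis is rejected, the maximum with 1 is inactive, and [m] cancels from the
   ratio. *)
have := @Gmax_uhat_cvg _ _ _ _ D0 D_mono D_cont D_concave D_sat D_total c_gt0 _
  alpha_gt0 supercrit _ _ (near_prob_filter P) _ _ _ B_unif chat_cvg Wz_opt.
move=> /cvgr_gt/(_ _ us0); apply: filterS => -[m x] /=.
set z := (m, x); set uh := crossing _.
have GhatE : (fun u => Gemp alpha B z (Wz z u) u) =
    Ghat m (fun g i => p m g i x) alpha (W m x).
  by apply/funext => u; rewrite GempE.
have ADDOW_E : ADDOW m x = [set j : hyps (n m) |
    (p m (tag j) (tagged j) x <= alpha * uh * W m x uh (tag j))%R]%SET.
  by rewrite /ADDOW /MWBH /uh GhatE.
set t := fun g => alpha * uh * W m x uh g.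
have card_rej : #|ADDOW m x|%:R =
    \sum_g \sum_(i < n m g) (p m g i x <= t g)%R%:R :> R.
  by rewrite ADDOW_E (card_hyps R (fun g i => p m g i x <= t g)).
have card_false : #|ADDOW m x :&: true_nulls (H m)|%:R =
    \sum_g \sum_(i < n m g) ((p m g i x <= t g)%R && ~~ H m g i)%:R :> R.
  rewrite -(card_hyps R (fun g i => (p m g i x <= t g) && ~~ H m g i)).
  by rewrite ADDOW_E; congr ((#|pred_of_set _|)%:R); apply/setP => j; rewrite !inE.
rewrite (_ : Gemp alpha B z (Wz z uh) uh = m%:R^-1 * #|ADDOW m x|%:R); last first.
  by rewrite card_rej /Gemp /B mulr_sumr.
rewrite (_ : \sum_g A g z _ =
    m%:R^-1 * #|ADDOW m x :&: true_nulls (H m)|%:R); last first.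
  by rewrite card_false mulr_sumr.
have [->|m0] := eqVneq (m%:R : R) 0; first by rewrite invr0 mul0r ltxx.
have [S0|S0] := posnP #|ADDOW m x|; first by rewrite S0 mulr0 ltxx.
by move=> _; rewrite (maxn_idPl S0) invfM invrK mulrACA mulVf// mul1r.
Unshelve. all: end_near. Qed.
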